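(* Let $G$ be a weakly hyperbolic group, i.e. a countable group admitting a nonelementary action by isometries on a separable hyperbolic metric space $X$. Let $\mu$ be any nonelementary probability measure on $G$ with respect to such an action, let $k\ge1$ be an integer, and let $\Gamma(n)=\langle w^1_n,\ldots,w^k_n\rangle\le G$, where $(w^1_n)_{n\in\mathbb{N}},\ldots,(w^k_n)_{n\in\mathbb{N}}$ are $k$ independent random walks on $G$ whose increments are distributed according to $\mu$. Then $$\mathbb{P}\big[\Gamma(n)\text{ is a free group and (when $G$ is finitely generated) is undistorted in }G\big]\to1\quad\text{as }n\to\infty.$$
   Context: A metric space $X$ is hyperbolic if for some $\delta\ge0$ one has $(x\cdot y)_w\ge\min\{(x\cdot z)_w,(z\cdot y)_w\}-\delta$ for all $x,y,z,w\in X$, where $(y\cdot z)_x=\frac12(d(x,y)+d(x,z)-d(y,z))$ is the Gromov product. An isometry $g$ of $X$ is loxodromic if $\liminf_{n\to\infty}d(x_0,g^nx_0)/n>0$ for some $x_0\in X$. An isometric action of $G$ on $X$ is nonelementary if there are $g,h\in G$ acting loxodromically whose fixed point sets on the Gromov boundary $\partial X$ are disjoint. A probability measure $\mu$ on $G$ is nonelementary with respect to the action if the semigroup generated by the support of $\mu$ is a subgroup of $G$ whose action on $X$ is nonelementary. A random walk on $G$ with increments distributed according to $\mu$ is the sequence $w_n=g_1g_2\cdots g_n$, where $(g_i)_{i\ge1}$ are independent $G$-valued random variables each with distribution $\mu$. A finitely generated subgroup $H$ of a finitely generated group $G$ is undistorted if the inclusion $H\hookrightarrow G$ is a quasi-isometric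 embedding with respect to word metrics from finite generating sets. *)

(* Defs.v *)
From HB Require Import structures.
From mathcomp Require Import all_boot all_order all_algebra.
From mathcomp Require Import all_classical all_reals all_analysis.

Set Implicit Arguments.
Unset Strict Implicit.
Unset Printing Implicit Defensive.

Import Order.TTheory GRing.Theory Num.Theory.
Import numFieldNormedType.Exports.

Local Open Scope classical_set_scope.
Local Open Scope ring_scope.

Section HyperbolicSpaces.
Context {R : realType} {X : metricType R}.

Definition separable : Prop :=
  exists2 A : set X, countable A & dense A.

Definition gromov_product (w x y : X) : R :=
  (mdist w x + mdist w y - mdist x y) / 2.

Definition hyperbolic : Prop :=
  exists2 delta : R, 0 <= delta &
    forall x y z w : X,
      Num.min (gromov_product w x z) (gromov_product w z y) - delta
        <= gromov_product w x y.

(* Sequential model of the Gromov boundary (no properness or geodesicity is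
   assumed): x and y are asymptotic when (x_i . y_j)_w -> +oo as i, j -> +oo
   independently. Base points only change Gromov products by a bounded
   amount, so "for all w" and "for some w" agree. A sequence converges to
   infinity when it is asymptotic to itself. *)
Definition asymptotic (x y : nat -> X) : Prop :=
  forall w : X,
    (fun ij : nat * nat => gromov_product w (x ij.1) (y ij.2))
      @ (\oo, \oo) --> +oo.

Definition converges_to_infinity (x : nat -> X) : Prop := asymptotic x x.

Definition boundary_class (x : nat -> X) : set (nat -> X) :=
  [set y | converges_to_infinity y /\ asymptotic x y].

(* A boundary point is an equivalence class of sequences. *)
Definition gromov_boundary : set (set (nat -> X)) :=
  [set xi | exists2 x, converges_to_infinity x & xi = boundary_class x].

Definition boundary_map (f : X -> X) (xi : set (nat -> X)) : set (nat -> X) :=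
  (fun x : nat -> X => f \o x) @` xi.

Definition boundary_fixed_points (f : X -> X) : set (set (nat -> X)) :=
  [set xi | gromov_boundary xi /\ boundary_map f xi = xi].

End HyperbolicSpaces.

Arguments separable {R} X.
Arguments hyperbolic {R} X.

Section Actions.
Context {R : realType} {G : groupType} {X : metricType R}.
Variable act : G -> X -> X.

Definition isometric_action : Prop :=
  [/\ forall x, act 1%g x = x,
      forall g h x, act (g * h)%g x = act g (act h x)
    & forall g x y, mdist (act g x) (act g y) = mdist x y].

(* The term n = 0 is a division by zero, which is irrelevant to the liminf. *)
Definition loxodromic (g : G) : Prop :=
  exists x0 : X,
    (0 < limn_einf (fun n : nat =>
           (mdist x0 (act (g ^+ n)%g x0) / n%:R)%:E))%E.

(* The action of a subgroup (given as a subset) H of G is nonelementary. *)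
Definition nonelementary_on (H : set G) : Prop :=
  exists g h : G,
    [/\ H g, H h, loxodromic g, loxodromic h
      & boundary_fixed_points (act g) `&` boundary_fixed_points (act h)
        = set0].

End Actions.

Section Groups.
Context {G : groupType}.
Implicit Types (S B H : set G) (w : seq (G * bool)).

Definition subgroup H : Prop := group_closed [in H].

Definition generated_subgroup S : set G := smallest subgroup S.

Definition generated_semigroup S : set G :=
  smallest (fun M : set G => mulg_closed [in M]) S.

Definition finitely_generated H : Prop :=
  exists2 S, finite_set S & generated_subgroup S = H.

(* The letter (s, false) stands for s and (s, true) for its inverse. *)
Definition letter_value (a : G * bool) : G :=
  if a.2 then a.1^-1%g else a.1.

Definition word_value w : G := (\prod_(a <- w) letter_value a)%g.

Definition word_over S w : Prop := forall a, a \in w -> S a.1.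

Definition reduced_word w : bool :=
  sorted (fun a b : G * bool => b != (a.1, ~~ a.2)) w.

(* A subgroup H is free when it has a basis B: every element of H is the value
   of exactly one reduced word over B. *)
Definition free_subgroup H : Prop :=
  subgroup H /\
  exists2 B, B `<=` H &
    forall h, H h ->
      exists! w, [/\ word_over B w, reduced_word w & word_value w = h].

(* The least length of a word over S representing g; the infimum is taken over
   a nonempty set, hence is a minimum, when g is in the subgroup generated
   by S. *)
Definition word_length (R : realType) S (g : G) : R :=
  inf [set (size w)%:R | w in [set w | word_over S w /\ word_value w = g]].

Definition word_dist (R : realType) S (x y : G) : R :=
  word_length R S (x^-1 * y)%g.

Definition quasi_isometric_inclusion (R : realType) H (dH dG : G -> G -> R) :
    Prop :=
  exists K C : R, [/\ 1 <= K, 0 <= C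
    & forall x y, H x -> H y ->
        K^-1 * dH x y - C <= dG x y /\ dG x y <= K * dH x y + C].

(* For G finitely generated: word metrics of different finite generating sets
   are bi-Lipschitz equivalent, so quantifying over all of them is the same as
   fixing one for H and one for G. *)
Definition undistorted (R : realType) H : Prop :=
  [/\ subgroup H, finitely_generated H &
    forall S T : set G,
      finite_set S -> generated_subgroup S = H ->
      finite_set T -> generated_subgroup T = [set: G] ->
      quasi_isometric_inclusion H (word_dist R S) (word_dist R T)].

End Groups.

(* G with its discrete sigma-algebra. *)
Definition discrete (G : groupType) : Type := G.

HB.instance Definition _ (G : groupType) := Group.on (discrete G).
HB.instance Definition _ (G : groupType) :=
  isPointed.Build (discrete G) (1%g : G).
HB.instance Definition _ (G : groupType) :=
  @isMeasurable.Build default_measure_display (discrete G)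
    discrete_measurable discrete_measurable0
    discrete_measurableC discrete_measurableU.

Section RandomWalks.
Context {R : realType} {G : groupType}.
Variable mu : probability (discrete G) R.

Definition support : set G := [set g | (0 < mu [set g])%E].

Definition nonelementary_measure (X : metricType R) (act : G -> X -> X) :
    Prop :=
  subgroup (generated_semigroup support) /\
  nonelementary_on act (generated_semigroup support).

Context {d : measure_display} {Omega : measurableType d}.
Variable P : probability Omega R.

(* Mutual independence of a family of sets of events. *)
Definition mutually_independent (I : eqType) (F : I -> set (set Omega)) :
    Prop :=
  forall (s : seq I) (A : I -> set Omega),
    uniq s -> (forall i, i \in s -> F i (A i)) ->
    P (\bigcap_(i in [set` s]) A i) = (\prod_(i <- s) P (A i))%E.

Definition process_sigma_algebra (w : nat -> Omega -> discrete G) :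
    set (set Omega) :=
  <<s \bigcup_n g_sigma_algebra_preimage (w n) >>.

(* The increments are indexed from 0, so w n is the product of the first n of
   them and w 0 = 1. *)
Definition random_walk (w : nat -> Omega -> discrete G) : Prop :=
  exists g : nat -> {RV P >-> discrete G},
    [/\ forall i A, distribution P (g i) A = mu A,
        mutually_independent (fun i => g_sigma_algebra_preimage (g i))
      & forall n omega, w n omega = (\prod_(i < n) g i omega)%g].

Definition independent_random_walks (k : nat)
    (w : 'I_k -> nat -> Omega -> discrete G) : Prop :=
  (forall j, random_walk (w j)) /\
  mutually_independent (fun j => process_sigma_algebra (w j)).

End RandomWalks.

Definition walk_subgroup (G : groupType) (Omega : Type) (k : nat)
    (w : 'I_k -> nat -> Omega -> discrete G) (n : nat) (omega : Omega) :
    set G :=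
  generated_subgroup (range (fun j => w j n omega)).

(* Main.v *)
Require Import Defs.
From mathcomp Require Import all_boot all_order all_algebra.
From mathcomp Require Import all_classical all_reals all_analysis.
From mathcomp Require Import measurable_realfun zify lra.
Import Order.TTheory GRing.Theory Num.Theory.
Import numFieldNormedType.Exports.
Local Open Scope classical_set_scope.
Local Open Scope ring_scope.
Set Implicit Arguments.
Unset Strict Implicit.
Unset Printing Implicit Defensive.

(** Write [|g|] for the distance from a base point [o] to [g o]. The proof reduces
    the statement to a ping-pong condition on the [2k] letters [w^j_n] and
    [(w^j_n)^-1], and then shows that this condition fails with a probability that
    tends to 0. The only input from hyperbolic geometry is the four-point
    inequality.

    Ping-pong. Suppose that any two different letters [a], [b] satisfy
    [d(a o, b o) >= max(|a|, |b|) + 2 delta + 1] ([antipodal]). By the four-point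
    inequality ([chain_step]) every letter of a reduced word then takes the orbit
    path at least 1 further away from its start, so that a reduced word of length
    [l] has displacement at least [l]. Hence the letters generate a free group, and
    this group is undistorted because displacement is at most proportional to word
    length in the ambient group ([antipodal_generators_free],
    [antipodal_generators_undistorted]).

    What has to be estimated. The condition on [a], [b] holds as soon as [|a|] and
    [|b|] are large compared with the Gromov product of [a o] and [b o]. For
    letters from different walks, which are independent, it suffices that a walk and
    its inverse escape ([escapes]) and that for every point [b], uniformly in [b],
    the walk has bounded Gromov product with [b] up to small probability
    ([avoids_directions]). The pair [w_n], [w_n^-1] is reduced to independent
    elements by cutting the walk into halves [w_n = u v]: without cancellation
    between [u] and [v], the path to [w_n o] starts in the direction of [u o] and
    the path to [w_n^-1 o] in the direction of [v^-1 o]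
    ([walk_inverse_antipodal]).

    Anticoncentration. Both estimates are instances of one argument
    ([anticoncentration]). Consider a class of subsets of [G] stable under
    translation, such as the elements that move [o] into a given ball, and let
    [t] bound the probabilities at late times of all sets of the class. Condition
    on the first [m] steps: if each of [M] elements [s] is reached with probability
    at least [c], and if each [x] has [s x] in a given set of the class for at most
    2 of these [s], then the bound [t] improves to [2 c + (1 - c M) t]. So the
    optimal [t] is at most [2 / M]. Shadows are stable under translation only up to
    a change of their depth, whence the quantifier on [L].

    Schottky families. It remains to find, for every [M], a family of [M] elements
    reached at the same time [m], far from [o] compared with their pairwise Gromov
    products, and likewise for their inverses; such elements spread any point to
    different places ([schottky_count]). Two loxodromic elements with disjoint
    fixed points have powers [f], [e] whose orbits diverge from each other, and
    [f^(iN) e^q f^((M-i)N)] for [i < M] is such a family when [q] is large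
    ([large_schottky_family]). *)

(** * Gromov products in hyperbolic spaces *)

Section GromovProducts.
Context {R : realType} {X : metricType R}.
Implicit Types x y z t w : X.

Local Notation d := (@mdist R X).
Local Notation gp := (@gromov_product R X).

Lemma gromov_productC w x y : gp w x y = gp w y x.
Proof. by rewrite /gromov_product (metric_sym x y) (addrC (d w x)). Qed.

Lemma gromov_product_le w x y : gp w x y <= d w x.
Proof.
rewrite /gromov_product; have := metric_triangle w x y; lra.
Qed.

Lemma gromov_product_moved w x y y' : gp w x y' <= gp w x y + d y y'.
Proof.
rewrite /gromov_product.
have := metric_triangle w y y'; have := metric_triangle x y' y.
rewrite (metric_sym y' y); lra.
Qed.

Lemma gromov_product_rebased w w' x y : gp w' x y <= gp w x y + d w w'.
Proof.
rewrite /gromov_product.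
have := metric_triangle w' w x; have := metric_triangle w' w y.
rewrite (metric_sym w' w); lra.
Qed.

(** Turns a small product at one end of a side into a large one at the other end;
    this is how points are shown to lie in the direction of others. *)
Lemma gromov_product_side w x y : gp w x y + gp x w y = d w x.
Proof. rewrite /gromov_product (metric_sym x w); lra. Qed.

Variable delta : R.
Hypothesis hyp : forall x y z w, Num.min (gp w x z) (gp w z y) - delta <= gp w x y.

Lemma hyperbolicityP c x y z w :
  c <= gp w x z -> c <= gp w z y -> c - delta <= gp w x y.
Proof.
move=> h1 h2; apply: le_trans (hyp x y z w).
by rewrite lerD2r le_min h1 h2.
Qed.

(** Hyperbolicity without a base point: of the three ways to pair off four
    points, the two largest sums of distances agree up to [2 * delta]. *)
Lemma four_point x y z t :
  d x z + d y t <= d x y + d z t + 2 * delta \/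
  d x z + d y t <= d x t + d y z + 2 * delta.
Proof.
have := hyp y t z x; rewrite /Num.min /gromov_product.
by case: ifP => _ h; [right|left]; lra.
Qed.

End GromovProducts.

(** * Isometric actions *)

Section IsometricActions.
Context {R : realType} {G : groupType} {X : metricType R}.
Variables (act : G -> X -> X) (act_isom : isometric_action act).
Implicit Types (g h : G) (x y : X).

Local Notation d := (@mdist R X).
Local Notation gp := (@gromov_product R X).

Lemma isometric_act1 x : act 1%g x = x.
Proof. by case: act_isom. Qed.

Lemma isometric_actM g h x : act (g * h)%g x = act g (act h x).
Proof. by case: act_isom. Qed.

Lemma mdist_act g x y : d (act g x) (act g y) = d x y.
Proof. by case: act_isom. Qed.

Lemma isometric_actK g : cancel (act g) (act g^-1%g).
Proof. by move=> x; rewrite -isometric_actM mulVg isometric_act1. Qed.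

Lemma isometric_actKV g : cancel (act g^-1%g) (act g).
Proof. by move=> x; rewrite -isometric_actM mulgV isometric_act1. Qed.

Lemma gromov_product_act g w x y : gp (act g w) (act g x) (act g y) = gp w x y.
Proof. by rewrite /gromov_product !mdist_act. Qed.

Lemma mdist_actl g x y : d (act g x) y = d x (act g^-1%g y).
Proof. by rewrite -(mdist_act g^-1%g) isometric_actK. Qed.

Lemma gromov_product_actl g w x y :
  gp (act g w) x y = gp w (act g^-1%g x) (act g^-1%g y).
Proof. by rewrite -(gromov_product_act g^-1%g) isometric_actK. Qed.

Variable o : X.

Definition displacement g : R := d o (act g o).

Lemma displacement1 : displacement 1%g = 0.
Proof. by rewrite /displacement isometric_act1 mdistxx. Qed.

Lemma displacement_ge0 g : 0 <= displacement g.
Proof. exact: mdist_ge0. Qed.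

Lemma displacementV g : displacement g^-1%g = displacement g.
Proof. by rewrite /displacement -mdist_actl metric_sym. Qed.

Lemma displacementM g h : displacement (g * h)%g <= displacement g + displacement h.
Proof.
rewrite /displacement isometric_actM; apply: le_trans (metric_triangle _ (act g o) _) _.
by rewrite mdist_act.
Qed.

Lemma mdist_orbit g h : d (act g o) (act h o) = displacement (g^-1 * h)%g.
Proof. by rewrite mdist_actl -isometric_actM. Qed.

Lemma displacementX g n : displacement (g ^+ n)%g <= displacement g *+ n.
Proof.
elim: n => [|n IH]; first by rewrite expg0 displacement1 mulr0n.
by rewrite expgS mulrS; apply: le_trans (displacementM _ _) _; rewrite lerD2l.
Qed.

End IsometricActions.

(** * Orbits of loxodromic isometries *)

Lemma natr_above {R : realType} (A : R) : exists n : nat, A <= n%:R.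
Proof.
exists (Num.bound `|A|); apply: le_trans (ler_norm A) _.
by apply/ltW/archi_boundP.
Qed.

Section Boundary.
Context {R : realType} {X : metricType R}.
Implicit Types (x y z : nat -> X) (o : X).

Local Notation d := (@mdist R X).
Local Notation gp := (@gromov_product R X).

Lemma asymptoticP o x y : asymptotic x y <->
  forall A : R, exists N, forall i j, (N <= i)%N -> (N <= j)%N -> A <= gp o (x i) (y j).
Proof.
split=> [xy A|xy w].
  have /cvgryPge/(_ A)[[P Q] [/= [N1 _ P1] [N2 _ Q2]] PQ] := xy o.
  exists (maxn N1 N2) => i j; rewrite !geq_max => /andP[i1 _] /andP[_ j2].
  by apply: (PQ (i, j)); split; [exact: P1|exact: Q2].
apply/cvgryPge => A; have [N xyN] := xy (A + d o w).
exists ([set i | N <= i]%N, [set j | N <= j]%N); first by split; exists N.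
move=> [i j] [/= Ni Nj]; have := xyN _ _ Ni Nj.
have := gromov_product_rebased w o (x i) (y j); rewrite (metric_sym w); lra.
Qed.

Lemma asymptotic_sym x y : asymptotic x y -> asymptotic y x.
Proof.
move=> /asymptoticP xy; apply/(asymptoticP (x 0)) => A.
have [N xyN] := xy (x 0) A; exists N => i j Ni Nj.
by rewrite gromov_productC; exact: xyN.
Qed.

(** Convergence to infinity at a linear rate, uniformly in both indices; passing to
    a power of the isometry normalises the rate to 1. *)
Definition radial o x := forall i j, (minn i j)%:R <= gp o (x i) (x j).

Lemma radial_converges o x : radial o x -> converges_to_infinity x.
Proof.
move=> rx; apply/(asymptoticP o) => A; have [N AN] := natr_above A.
exists N => i j Ni Nj; apply: le_trans AN (le_trans _ (rx i j)).
by rewrite ler_nat leq_min Ni.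
Qed.

Variable delta : R.
Hypothesis hyp : forall x y z w : X, Num.min (gp w x z) (gp w z y) - delta <= gp w x y.

Lemma asymptotic_trans y x z : asymptotic x y -> asymptotic y z -> asymptotic x z.
Proof.
move=> /(asymptoticP (x 0)) xy /(asymptoticP (x 0)) yz.
apply/(asymptoticP (x 0)) => A.
have [N1 xyN] := xy (A + delta); have [N2 yzN] := yz (A + delta).
exists (maxn N1 N2) => i j; rewrite !geq_max => /andP[i1 i2] /andP[j1 j2].
have := hyperbolicityP hyp (xyN i (maxn N1 N2) i1 (leq_maxl _ _))
  (yzN (maxn N1 N2) j (leq_maxr _ _) j2).
by rewrite addrK.
Qed.

Lemma asymptotic_boundary_class x y : asymptotic x y -> boundary_class x = boundary_class y.
Proof.
move=> xy; apply/seteqP; split=> z [zi xz]; split=> //.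
  by apply: asymptotic_trans xz; exact: asymptotic_sym.
exact: asymptotic_trans xz.
Qed.

(** Each sequence keeps its direction, so hyperbolicity propagates a small product
    from arbitrarily late pairs of indices to all pairs. *)
Lemma nonasymptotic_bounded o x y :
  radial o x -> radial o y -> ~ asymptotic x y ->
  exists C : R, forall i j, gp o (x i) (y j) <= C.
Proof.
move=> rx ry nxy.
have [B HB] : exists B : R, forall N, exists i j, [/\ (N <= i)%N, (N <= j)%N
    & gp o (x i) (y j) < B].
  apply: contrapT => /forallNP nB; apply/nxy/(asymptoticP o) => A.
  have /existsNP[N HN] := nB A; exists N => i j Ni Nj.
  by rewrite leNgt; apply/negP => h; apply: HN; exists i, j.
have [I0 HI0] := natr_above (B + 2 * delta).
(* The sum bounds the products with an index below [I0], and [B] the others. *)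
exists (\sum_(i < I0) (d o (x i) + d o (y i)) + `|B| + 2 * `|delta|) => i j.
have sum_ge0 : 0 <= \sum_(i < I0) (d o (x i) + d o (y i)).
  by apply: sumr_ge0 => k _; rewrite addr_ge0 ?mdist_ge0.
have below k : (k < I0)%N -> d o (x k) + d o (y k) <= \sum_(i < I0) (d o (x i) + d o (y i)).
  move=> kI; rewrite (bigD1 (Ordinal kI)) //= lerDl.
  by apply: sumr_ge0 => l _; rewrite addr_ge0 ?mdist_ge0.
have := ler_norm B; have := normr_ge0 B; have := ler_norm delta.
have := normr_ge0 delta => h1 h2 h3 h4.
have [iI|Ii] := ltnP i I0.
  have := gromov_product_le o (x i) (y j); have := below i iI.
  have := mdist_ge0 o (y i); lra.
have [jI|Ij] := ltnP j I0.
  have := gromov_product_le o (y j) (x i); have := below j jI.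
  have := mdist_ge0 o (x j); rewrite gromov_productC; lra.
have [i' [j' [ii' jj' small]]] := HB (maxn i j).
have far : B + 2 * delta <= gp o (x i') (x i).
  apply: le_trans HI0 (le_trans _ (rx _ _)); rewrite ler_nat leq_min Ii andbT.
  by apply: leq_trans ii'; rewrite (leq_trans Ii) ?leq_maxl.
have far' : B + delta <= gp o (y j) (y j').
  apply: (@le_trans _ _ (I0%:R)); last first.
    apply: le_trans (ry _ _); rewrite ler_nat leq_min Ij /=.
    by apply: leq_trans jj'; rewrite (leq_trans Ij) ?leq_maxr.
  suff d0 : 0 <= delta by lra.
  have := hyp o o o o; rewrite minxx; lra.
rewrite leNgt; apply/negP => big.
have big' : B + 2 * delta <= gp o (x i) (y j) by lra.
have := hyperbolicityP hyp far big'; rewrite (_ : B + _ - _ = B + delta); last lra.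
by move=> /(hyperbolicityP hyp)/(_ far'); lra.
Qed.

End Boundary.

Section LoxodromicOrbits.
Context {R : realType} {G : groupType} {X : metricType R}.
Variables (act : G -> X -> X) (act_isom : isometric_action act).
Variable delta : R.
Hypothesis hyp : forall x y z w : X,
  Num.min (gromov_product w x z) (gromov_product w z y) - delta <= gromov_product w x y.
Variable o : X.
Implicit Types (f g h e : G) (x y : nat -> X).

Local Notation d := (@mdist R X).
Local Notation gp := (@gromov_product R X).
Local Notation "`[ g ]" := (displacement act o g) (format "`[ g ]").

Lemma hyperbolic_constant_ge0 : 0 <= delta.
Proof. have := hyp o o o o; rewrite minxx; lra. Qed.

Lemma boundary_map_class_subset g x :
  converges_to_infinity x -> (exists C : R, forall n, d (act g (x n)) (x n) <= C) ->
  boundary_map (act g) (boundary_class x) `<=` boundary_class x.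
Proof.
move=> xoo [C gxC] _ [z [zoo xz] <-].
have moved w u v : gp w u (act g v) = gp (act g^-1%g w) (act g^-1%g u) v.
  by rewrite gromov_product_actl // invgK isometric_actKV.
split; apply/(asymptoticP o) => A.
  have /asymptoticP-/(_ (act g^-1%g o))/(_ A)[N zN] := zoo.
  by exists N => i j Ni Nj; rewrite /= moved isometric_actK //; exact: zN.
have /asymptoticP-/(_ (act g^-1%g o))/(_ (A + C))[N xzN] := xz.
exists N => i j Ni Nj; rewrite /= moved; have := xzN i j Ni Nj.
have := gromov_product_moved (act g^-1%g o) (z j) (act g^-1%g (x i)) (x i).
rewrite !(gromov_productC _ (z j)) metric_sym -mdist_actl // metric_sym.
have := gxC i; rewrite metric_sym; lra.
Qed.

(** Bounded perturbations change Gromov products by a bounded amount, hence do not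
    change boundary classes. *)
Lemma boundary_class_fixed g x :
  converges_to_infinity x -> (exists C : R, forall n, d (act g (x n)) (x n) <= C) ->
  boundary_fixed_points (act g) (boundary_class x).
Proof.
move=> xoo gx; split; first by exists x.
apply/seteqP; split; first exact: boundary_map_class_subset.
have gVx : exists C : R, forall n, d (act g^-1%g (x n)) (x n) <= C.
  by have [C gxC] := gx; exists C => n; rewrite mdist_actl // invgK metric_sym.
move=> z xz; exists (act g^-1%g \o z).
  by apply: (boundary_map_class_subset xoo gVx); exists z.
by apply/funext => n /=; rewrite isometric_actKV.
Qed.

(** The local-to-global principle: progress away from [x] made from [y] to [z]
    continues to [t] if the path hardly backtracks at [z]. Of the two cases of
    [four_point], one contradicts the progress from [y] to [z] and the other is the
    progress from [z] to [t]. *)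
Lemma chain_step a (x y z t : X) : 0 < a ->
  d y z + 2 * delta + a <= d y t -> d z t + 2 * delta + a <= d y t ->
  d x y + a <= d x z -> d x z + a <= d x t.
Proof. by move=> a0 h1 h2 h3; case: (four_point hyp x y z t); lra. Qed.

(** The non-backtracking condition of [chain_step] along the orbit of [f]. *)
Definition stretched f := `[f] + 2 * delta + 1 <= `[f ^+ 2]%g.

Lemma stretchedV f : stretched f -> stretched f^-1%g.
Proof. by rewrite /stretched expVgn !displacementV. Qed.

Lemma stretched_displacementS f n : stretched f -> `[f ^+ n]%g + 1 <= `[f ^+ n.+1]%g.
Proof.
move=> sf; elim: n => [|n IH].
  rewrite expg0 displacement1 // expg1; have := displacementM act_isom o f f.
  by have := hyperbolic_constant_ge0; move: sf; rewrite /stretched expg2; lra.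
have orbit i j : d (act (f ^+ i)%g o) (act (f ^+ (i + j))%g o) = `[f ^+ j]%g.
  by rewrite mdist_orbit // expgnDr mulKg.
apply: (@chain_step _ o (act (f ^+ n)%g o) (act (f ^+ n.+1)%g o)) => //.
- by have := orbit n 1; have := orbit n 2; rewrite addn1 addn2 => -> ->.
- by have := orbit n.+1 1; have := orbit n 2; rewrite addn1 addn2 => -> ->.
Qed.

Lemma stretched_displacementD f n m : stretched f ->
  `[f ^+ n]%g + m%:R <= `[f ^+ (n + m)]%g.
Proof.
move=> sf; elim: m => [|m IH]; first by rewrite addn0 addr0.
have := stretched_displacementS (n + m) sf; rewrite addnS -natr1; lra.
Qed.

Lemma stretched_displacement_ge f n : stretched f -> n%:R <= `[f ^+ n]%g.
Proof.
by move=> /(stretched_displacementD 0 n); rewrite expg0 displacement1 // add0r.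
Qed.

Lemma stretched_radial f : stretched f -> radial o (fun n => act (f ^+ n)%g o).
Proof.
move=> sf i j; wlog ij : i j / (i <= j)%N.
  by move=> h; case/orP: (leq_total i j) => /h //; rewrite minnC gromov_productC.
have := stretched_displacementD (j - i) i sf; rewrite subnK // => le_j.
have := stretched_displacement_ge i sf => le_i.
rewrite (minn_idPl ij) /gromov_product mdist_orbit //.
have -> : ((f ^+ i)^-1 * f ^+ j)%g = (f ^+ (j - i))%g.
  by rewrite -{1}(subnKC ij) expgnDr mulKg.
by move: le_j le_i; rewrite /displacement; lra.
Qed.

Lemma loxodromic_displacement g : loxodromic act g ->
  exists2 c : R, 0 < c & exists N, forall n, (N <= n)%N -> c * n%:R <= `[g ^+ n]%g.
Proof.
move=> [x]; set u := fun n => _.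
rewrite limn_einf_lim (cvg_lim _ (@cvg_einfs_sup _ u)) // => sup_gt0.
have [N uN] : exists N, (0 < einfs u N)%E.
  apply: contrapT => /forallNP h; move: sup_gt0; apply/negP; rewrite -leNgt.
  by apply: ge_ereal_sup => _ [n _ <-]; rewrite leNgt; exact/negP/h.
have low n : (N <= n)%N -> (einfs u N <= u n)%E.
  by move=> Nn; apply: ereal_inf_lbound; exists n.
have finN : einfs u N \is a fin_num.
  by rewrite ge0_fin_numE ?ltW // (le_lt_trans (low N _)) // ltry.
have c0 : 0 < fine (einfs u N) by rewrite fine_gt0 // uN /= -ge0_fin_numE // ltW.
have [M HM] := natr_above (4 * d o x / fine (einfs u N)).
exists (fine (einfs u N) / 2); first by rewrite divr_gt0.
exists (maxn N M.+1) => n; rewrite geq_max => /andP[Nn Mn].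
have n0 : (0 : R) < n%:R by rewrite ltr0n; case: (n) Mn.
have := low n Nn; rewrite -(fineK finN) lee_fin ler_pdivlMr // => low_n.
have : 4 * d o x <= fine (einfs u N) * n%:R.
  rewrite (mulrC (fine _)) -ler_pdivrMr //; apply: le_trans HM _.
  by rewrite ler_nat ltnW.
have := metric_triangle x o (act (g ^+ n)%g x).
have := metric_triangle o (act (g ^+ n)%g o) (act (g ^+ n)%g x).
rewrite mdist_act // (metric_sym x o) /displacement; lra.
Qed.

(** If no power were stretched then doubling the exponent would only add a
    constant to the displacement, which would grow logarithmically. *)
Lemma loxodromic_stretched g : loxodromic act g -> exists p, stretched (g ^+ p)%g.
Proof.
move=> /loxodromic_displacement[c c0 [N gN]]; apply: contrapT => /forallNP slow.
set K := 2 * delta + 1; have := hyperbolic_constant_ge0 => delta0.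
have log k : `[g ^+ (2 ^ k)]%g <= `[g] + k%:R * K.
  elim: k => [|k IH]; first by rewrite expn0 expg1 mul0r addr0.
  have /negP := slow (2 ^ k)%N; rewrite -ltNge -expgnA -expnSr => lt_k.
  apply: le_trans (ltW lt_k) _; rewrite -natr1 mulrDl mul1r /K; move: IH.
  rewrite /K; lra.
have [M HM] := natr_above ((`[g] + 2 * K) / c).
pose j := (maxn N M).+1.
have Nj : (N <= 2 ^ j.*2)%N.
  rewrite (leq_trans (leq_maxl N M)) //.
  by rewrite (leq_trans (leqnSn _)) // (leq_trans (ltnW (ltn_expl j (_ : 1 < 2)%N))) // leq_exp2l // -addnn leq_addr.
have jj : (j * j <= 2 ^ j.*2)%N.
  by rewrite -addnn expnD leq_mul // ltnW // ltn_expl.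
have j0 : (0 : R) < j%:R by rewrite ltr0n.
have j1 : (1 : R) <= j%:R by rewrite ler1n.
have Mj : (M%:R : R) < j%:R by rewrite ltr_nat ltnS leq_maxr.
have g0 := displacement_ge0 act o g.
have : c * (j%:R * j%:R) <= `[g] + j.*2%:R * K.
  apply: le_trans (log j.*2); apply: le_trans (gN _ Nj).
  by rewrite ler_pM2l // -natrM ler_nat.
have : `[g] + j.*2%:R * K <= j%:R * (`[g] + 2 * K).
  rewrite -addnn natrD.
  have : `[g] <= j%:R * `[g] by rewrite ler_peMl.
  lra.
move=> h1 h2; have {h1 h2} := le_trans h2 h1.
rewrite mulrCA ler_pM2l // leNgt => /negP; apply.
by move: HM; rewrite ler_pdivrMr // => HM; apply: le_lt_trans HM _; rewrite mulrC ltr_pM2l.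
Qed.

End LoxodromicOrbits.

(** * Arbitrarily large Schottky families *)

Section Schottky.
Context {R : realType} {G : groupType} {X : metricType R}.
Variables (act : G -> X -> X) (act_isom : isometric_action act).
Variable delta : R.
Hypothesis hyp : forall x y z w : X,
  Num.min (gromov_product w x z) (gromov_product w z y) - delta <= gromov_product w x y.
Variable o : X.
Implicit Types (f g h e : G) (x y : nat -> X).

Local Notation d := (@mdist R X).
Local Notation gp := (@gromov_product R X).
Local Notation "`[ g ]" := (displacement act o g) (format "`[ g ]").
Local Notation stretched := (stretched act delta o).

Definition transverse f e :=
  exists C : R, forall i j, gp o (act (f ^+ i)%g o) (act (e ^+ j)%g o) <= C.

Lemma orbit_class_fixed g f : commute g f -> stretched f ->
  boundary_fixed_points (act g) (boundary_class (fun n => act (f ^+ n)%g o)).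
Proof.
move=> gf sf; apply: (boundary_class_fixed act_isom o).
  exact/radial_converges/(stretched_radial act_isom hyp).
exists (d (act g o) o) => n.
rewrite -isometric_actM // (_ : g * f ^+ n = f ^+ n * g)%g; last exact: commuteX.
by rewrite isometric_actM // mdist_act.
Qed.

(** If the orbits of [f] and [e] were asymptotic, their common boundary point would
    be fixed by both [g] and [h]. *)
Lemma disjoint_fixed_points_transverse g h f e :
  boundary_fixed_points (act g) `&` boundary_fixed_points (act h) = set0 ->
  commute g f -> commute h e -> stretched f -> stretched e -> transverse f e.
Proof.
move=> gh0 gf he sf se.
apply: (nonasymptotic_bounded hyp); try exact: (stretched_radial act_isom hyp).
move=> /(asymptotic_boundary_class hyp) fe.
have : (boundary_fixed_points (act g) `&` boundary_fixed_points (act h))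
    (boundary_class (fun n => act (f ^+ n)%g o)).
  by split; [exact: orbit_class_fixed|rewrite fe; exact: orbit_class_fixed].
by rewrite gh0.
Qed.

(** Seen from [o], the elements lie in pairwise different directions, and so do
    their inverses; [r] is the margin by which displacements exceed twice the bound
    [C] on Gromov products. *)
Definition schottky (C r : R) (F : seq G) :=
  [/\ 0 <= C, uniq F, {in F, forall s, 2 * C + r <= `[s]}
    & {in F &, forall s t, s != t ->
        gp o (act s o) (act t o) <= C /\ gp o (act s^-1%g o) (act t^-1%g o) <= C}].

Lemma schottkyV C r F : schottky C r F -> schottky C r [seq s^-1%g | s <- F].
Proof.
move=> [C0 uF lF pF]; split=> //; first by rewrite map_inj_uniq //; exact: invg_inj.
  by move=> _ /mapP[s sF ->]; rewrite displacementV //; exact: lF.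
move=> _ _ /mapP[s sF ->] /mapP[t tF ->] st; rewrite !invgK.
by have [|? ?] := pF s t sF tF; [apply: contraNneq st => ->|].
Qed.

(** Since the orbit of [e] avoids the direction of [f^-1], a large power of [f]
    sends it into the direction of [f], which the orbit of [e] avoids too. *)
Lemma transverse_shifted f e : stretched f -> transverse f e -> transverse f^-1%g e ->
  exists (C : R) (N : nat), forall n q, (N <= n)%N ->
    gp o (act (f ^+ n * e ^+ q)%g o) (act (e ^+ q)%g o) <= C.
Proof.
move=> sf [C1 fe] [C2 fVe].
have [N HN] := natr_above (C1 + C2 + delta + 1).
exists (C1 + delta + 1), N => n q Nn.
have near_f : C1 + delta + 1 <= gp o (act (f ^+ n)%g o) (act (f ^+ n * e ^+ q)%g o).
  have := gromov_product_side o (act (f ^+ n)%g o) (act (f ^+ n * e ^+ q)%g o).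
  rewrite (gromov_product_actl act_isom) isometric_actM // !isometric_actK //.
  rewrite -[act (f ^+ n)^-1%g o]/(act (f ^- n)%g o) -expVgn.
  have := fVe n q; have := stretched_displacement_ge act_isom hyp n sf.
  have : (N%:R : R) <= n%:R by rewrite ler_nat.
  by rewrite /displacement; lra.
rewrite leNgt; apply/negP => big.
have := hyperbolicityP hyp near_f (ltW big); have := fe n q; lra.
Qed.

(** Undoing the common prefix [f ^+ b] and dropping the tails [v] and [v'] changes
    the Gromov product by at most their displacements. *)
Lemma schottky_pair_bound f e C N a b q v v' :
  (forall n q, (N <= n)%N ->
    gp o (act (f ^+ n * e ^+ q)%g o) (act (e ^+ q)%g o) <= C) ->
  (b + N <= a)%N ->
  gp o (act (f ^+ a * e ^+ q * v)%g o) (act (f ^+ b * e ^+ q * v')%g o)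
    <= C + `[f] *+ b + `[v] + `[v'].
Proof.
move=> shifted ba.
have [ba' Nab] : (b <= a)%N /\ (N <= a - b)%N by lia.
have := shifted (a - b)%N q Nab.
rewrite -(gromov_product_act act_isom (f ^+ b)%g) -!isometric_actM // !mulgA -expgnDr.
rewrite subnKC // => shifted_ab.
have tail g u : d (act g o) (act (g * u)%g o) = `[u] by rewrite mdist_orbit // mulKg.
have := gromov_product_rebased (act (f ^+ b)%g o) o
  (act (f ^+ a * e ^+ q)%g o) (act (f ^+ b * e ^+ q)%g o).
have := gromov_product_moved o (act (f ^+ a * e ^+ q * v)%g o)
  (act (f ^+ b * e ^+ q)%g o) (act (f ^+ b * e ^+ q * v')%g o).
have := gromov_product_moved o (act (f ^+ b * e ^+ q)%g o)
  (act (f ^+ a * e ^+ q)%g o) (act (f ^+ a * e ^+ q * v)%g o).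
rewrite !tail !(gromov_productC o (act (f ^+ b * e ^+ q)%g o)) metric_sym -/(`[_]).
have := displacementX act_isom o f b; rewrite -/(displacement _ _ _); lra.
Qed.

(** The family is [f^(iN) e^q f^((M-i)N)] for [i < M]. All its members are
    products of the same number of copies of [f] and of [e]; they leave [o]
    in the pairwise different directions [f^(iN) e^(+oo)], and their inverses in
    the directions [f^(-(M-i)N) e^(-oo)]. With [M], [N] fixed, the bound on the
    Gromov products does not depend on [q], while the displacements grow with [q]. *)
Lemma large_schottky_family (reach : nat -> G -> Prop) f e lf le M r :
  reach 0 1%g -> (forall m n g h, reach m g -> reach n h -> reach (m + n)%N (g * h)%g) ->
  reach lf f -> reach le e -> stretched f -> stretched e ->
  transverse f e -> transverse f^-1%g e -> transverse f e^-1%g -> transverse f^-1%g e^-1%g ->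
  exists m C F, [/\ size F = M, schottky C r F & forall s, s \in F -> reach m s].
Proof.
move=> reach1 reachM rf re sf se fe fVe feV fVeV.
have reachX g l : reach l g -> forall n, reach (n * l)%N (g ^+ n)%g.
  by move=> rg; elim=> [//|n IH]; rewrite mulSn expgS; exact: reachM.
have [C1 [N1 far1]] := transverse_shifted sf fe fVe.
have fVeV' : transverse f^-1^-1%g e^-1%g by rewrite invgK.
have [C2 [N2 far2]] := transverse_shifted (stretchedV act_isom sf) fVeV fVeV'.
pose N := (maxn N1 N2).+1; pose D := `[f] *+ (M * N).
have D0 : 0 <= D by rewrite mulrn_wge0 // displacement_ge0.
have fD n : (n <= M * N)%N -> `[f] *+ n <= D.
  by move=> nM; rewrite ler_wpMn2l // displacement_ge0.
pose C := `|C1| + `|C2| + 3 * D.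
have C0 : 0 <= C by rewrite /C; have := normr_ge0 C1; have := normr_ge0 C2; lra.
have C1C : C1 + 3 * D <= C by rewrite /C; have := ler_norm C1; have := normr_ge0 C2; lra.
have C2C : C2 + 3 * D <= C by rewrite /C; have := ler_norm C2; have := normr_ge0 C1; lra.
(* [q] is chosen last: [C] and [D] depend on [M] and [N] only. *)
have [q Hq] := natr_above (2 * C + `|r| + 1 + 2 * D).
pose s i := (f ^+ (i * N) * e ^+ q * f ^+ ((M - i) * N))%g.
have fX n : (n <= M * N)%N -> `[f ^+ n]%g <= D.
  by move=> nM; apply: le_trans (fD _ nM); exact: displacementX.
have iM i : (i < M)%N -> (i * N <= M * N)%N by move=> h; rewrite leq_mul2r ltnW ?orbT.
have iM' i : ((M - i) * N <= M * N)%N by rewrite leq_mul2r leq_subr orbT.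
have s_large i : (i < M)%N -> 2 * C + `|r| + 1 <= `[s i].
  move=> h.
  have := displacementM act_isom o (f ^- (i * N))%g (s i * (f ^- ((M - i) * N)))%g.
  have := displacementM act_isom o (s i) (f ^- ((M - i) * N))%g.
  rewrite !displacementV // {2}/s mulgK mulKg.
  have := fX _ (iM i h); have := fX _ (iM' i).
  have := stretched_displacement_ge act_isom hyp q se; lra.
have gap i j : (i < j)%N -> (i * N + N <= j * N)%N.
  by move=> ij; rewrite -mulSnr leq_mul2r ij orbT.
have sep i j : (i < j < M)%N -> gp o (act (s i) o) (act (s j) o) <= C /\
    gp o (act (s i)^-1%g o) (act (s j)^-1%g o) <= C.
  move=> /andP[ij jM]; have iltM := ltn_trans ij jM; split.
    rewrite gromov_productC /s.
    have := @schottky_pair_bound f e C1 N1 (j * N) (i * N) q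
      (f ^+ ((M - j) * N))%g (f ^+ ((M - i) * N))%g far1.
    have -> : (i * N + N1 <= j * N)%N.
      by apply: leq_trans (gap _ _ ij); rewrite leq_add2l leqW ?leq_maxl.
    have := fX _ (iM' i); have := fX _ (iM' j); have := fD _ (iM i iltM).
    move=> h1 h2 h3 /(_ isT); lra.
  have sV k : (s k)^-1%g = (f^-1 ^+ ((M - k) * N) * e^-1 ^+ q * f^-1 ^+ (k * N))%g.
    by rewrite /s !invgM !expVgn mulgA.
  rewrite !sV.
  have := @schottky_pair_bound f^-1%g e^-1%g C2 N2 ((M - i) * N) ((M - j) * N) q
      (f^-1 ^+ (i * N))%g (f^-1 ^+ (j * N))%g far2.
  have -> : ((M - j) * N + N2 <= (M - i) * N)%N.
    apply: leq_trans (gap (M - j)%N (M - i)%N _); last by lia.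
    by rewrite leq_add2l leqW ?leq_maxr.
  rewrite !expVgn !displacementV //.
  have := fX _ (iM _ jM); have := fX _ (iM _ iltM); have := fD _ (iM' j).
  move=> h1 h2 h3 /(_ isT); lra.
have s_inj i j : (i < M)%N -> (j < M)%N -> s i = s j -> i = j.
  wlog ij : i j / (i <= j)%N.
    by move=> h iM_ jM_; case/orP: (leq_total i j) => [|] /h h' E; [|symmetry]; exact: h'.
  move=> iM_ jM_ E; apply/eqP; rewrite eqn_leq ij leqNgt; apply/negP => lt_ij.
  have [] := sep i j; first by rewrite lt_ij.
  rewrite -E /gromov_product mdistxx -/(displacement _ _ _).
  by have := s_large i iM_; have := normr_ge0 r; lra.
exists (M * N * lf + q * le)%N, C, [seq s i | i <- iota 0 M]; split.
- by rewrite size_map size_iota.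
- split=> //.
  + rewrite map_inj_in_uniq ?iota_uniq // => i j; rewrite !mem_iota !add0n /=.
    exact: s_inj.
  + move=> _ /mapP[i + ->]; rewrite mem_iota /= add0n => iM_.
    by have := s_large i iM_; have := ler_norm r; lra.
  + move=> _ _ /mapP[i + ->] /mapP[j + ->]; rewrite !mem_iota !add0n /=.
    move=> iM_ jM_ sij.
    have [ij|ji|ij] := ltngtP i j; first by apply: sep; rewrite ij.
      by rewrite !(gromov_productC _ (act (s i) o)) (gromov_productC _ (act (s i)^-1%g o)); apply: sep; rewrite ji.
    by rewrite ij eqxx in sij.
- move=> _ /mapP[i + ->]; rewrite mem_iota /= add0n => iM_.
  have -> : (M * N * lf + q * le = i * N * lf + q * le + (M - i) * N * lf)%N.
    rewrite addnAC -mulnDl -mulnDl subnKC // ltnW //.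
  by apply: (reachM); [apply: reachM|]; exact: reachX.
Qed.

End Schottky.

(** * Shadows and balls meet few translates *)

Lemma count_le1 (T : eqType) (P : pred T) (s : seq T) :
  uniq s -> {in s &, forall x y, P x -> P y -> x = y} -> (count P s <= 1)%N.
Proof.
move=> us P1; rewrite -size_filter; have := filter_uniq P us.
have sub x : x \in [seq z <- s | P z] -> x \in s /\ P x by rewrite mem_filter => /andP[].
case: [seq z <- s | P z] sub => [|x [|y t]] //= sub.
have [xs Px] := sub x (mem_head _ _).
have [ys Py] : y \in s /\ P y by apply: sub; rewrite !inE eqxx orbT.
by rewrite (P1 x y xs ys Px Py) inE eqxx.
Qed.

Section SchottkyCounting.
Context {R : realType} {G : groupType} {X : metricType R}.
Variables (act : G -> X -> X) (act_isom : isometric_action act).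
Variable delta : R.
Hypothesis hyp : forall x y z w : X,
  Num.min (gromov_product w x z) (gromov_product w z y) - delta <= gromov_product w x y.
Variable o : X.
Implicit Types (s t : G) (x y b : X) (F : seq G) (C r L rho : R).

Local Notation d := (@mdist R X).
Local Notation gp := (@gromov_product R X).
Local Notation schottky := (schottky act o).

(** Because the points [s^-1 o] are in different directions, all [s] but one
    send [y] into the direction of [s o], and a point [b] lies in the direction
    of [s o] for at most one [s]. *)
Lemma schottky_count C r F y b (P : pred G) : schottky C r F ->
  {in F, forall s, P s ->
     C + r - delta <= gp o (act s o) (act s y) -> C + delta < gp o (act s o) b} ->
  (count P F <= 2)%N.
Proof.
move=> [C0 uF lF pF] Pb.
have forward s : s \in F -> gp o (act s^-1%g o) y <= C + delta ->
    C + r - delta <= gp o (act s o) (act s y).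
  move=> sF; have := gromov_product_side o (act s o) (act s y).
  rewrite (gromov_product_actl act_isom) isometric_actK //.
  by have := lF s sF; rewrite /displacement; lra.
pose back := [pred s | C + delta < gp o (act s^-1%g o) y].
pose front := [pred s | C + delta < gp o (act s o) b].
have sep z1 z2 z : C + delta < gp o z1 z -> C + delta < gp o z2 z -> C < gp o z1 z2.
  rewrite (gromov_productC o z2) => h1 h2; apply: lt_le_trans (hyp z1 z2 z o).
  by rewrite ltrBrDr lt_min h1.
have : (count P F <= count (predU back front) F)%N.
  rewrite -!size_filter; apply: uniq_leq_size; first exact: filter_uniq.
  move=> s; rewrite !mem_filter /= => /andP[Ps sF]; rewrite sF andbT.
  have [//|notbig] := boolP (C + delta < gp o (act s^-1%g o) y).
  apply: (Pb s sF Ps); apply: (forward s sF).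
  by rewrite leNgt.
move/leq_trans; apply.
have h1 : (count back F <= 1)%N.
  apply: count_le1 => // s t sF tF /= hs ht; apply/eqP/negPn/negP => st.
  by have [_] := pF s t sF tF st; rewrite leNgt (sep _ _ _ hs ht).
have h2 : (count front F <= 1)%N.
  apply: count_le1 => // s t sF tF /= hs ht; apply/eqP/negPn/negP => st.
  by have [+ _] := pF s t sF tF st; rewrite leNgt (sep _ _ _ hs ht).
by have := leq_add h1 h2; rewrite -count_predUI; apply: leq_trans (leq_addr _ _).
Qed.

Lemma schottky_shadow_count C r F y b L : schottky C r F ->
  3 * delta < r -> C + r - delta <= L ->
  (count (fun s => L <= gp o (act s y) b)%R F <= 2)%N.
Proof.
move=> sF r3 Lbig; apply: (schottky_count (y := y) (b := b) sF) => s _ Ls.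
by move=> /(hyperbolicityP hyp)/(_ (le_trans Lbig Ls)); lra.
Qed.

Lemma schottky_ball_count C r F y b rho : schottky C r F ->
  2 * delta + rho < r ->
  (count (fun s => d (act s y) b <= rho)%R F <= 2)%N.
Proof.
move=> sF rbig; apply: (schottky_count (y := y) (b := b) sF) => s _ near_b.
have := gromov_product_moved o (act s o) b (act s y); rewrite metric_sym; lra.
Qed.

End SchottkyCounting.

(** * Probabilities of countably valued events *)

Section CountableProbability.
Context {R : realType} {G : choiceType} {d : measure_display} {Omega : measurableType d}.
Variable P : probability Omega R.
Hypothesis G_countable : countable [set: G].
Implicit Types (A B : set Omega) (U V : Omega -> G).

Definition prob A : R := fine (P A).
Local Notation pr := prob.

Lemma prE A : measurable A -> P A = (pr A)%:E.
Proof. by move=> mA; rewrite fineK // fin_num_measure. Qed.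

Lemma pr_ge0 A : 0 <= pr A.
Proof. by rewrite fine_ge0. Qed.

Lemma pr_le1 A : measurable A -> pr A <= 1.
Proof. by move=> mA; rewrite -lee_fin -prE // probability_le1. Qed.

Lemma le_pr A B : measurable A -> measurable B -> A `<=` B -> pr A <= pr B.
Proof. by move=> mA mB AB; rewrite -lee_fin -!prE // le_measure ?inE. Qed.

Lemma prC A : measurable A -> pr (~` A) = 1 - pr A.
Proof.
move=> mA; apply: EFin_inj; rewrite -prE; last exact: measurableC.
by rewrite probability_setC // prE.
Qed.

Lemma prU A B : measurable A -> measurable B -> pr (A `|` B) <= pr A + pr B.
Proof.
move=> mA mB; rewrite -lee_fin EFinD -!prE //; last exact: measurableU.
exact: measureU2.
Qed.

Lemma pr_bigU (I : Type) (s : seq I) (F : I -> set Omega) :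
  (forall i, measurable (F i)) ->
  pr (\big[setU/set0]_(i <- s) F i) <= \sum_(i <- s) pr (F i).
Proof.
move=> mF; elim: s => [|i s IH]; first by rewrite !big_nil /prob measure0.
rewrite !big_cons; apply: le_trans (prU _ _) _ => //; last by rewrite lerD2l.
exact: bigsetU_measurable.
Qed.

(** Integrate the sum of the indicator functions. *)
Lemma pr_multiplicity (I : Type) (s : seq I) (F : I -> set Omega) (K : nat) :
  (forall i, measurable (F i)) ->
  (forall x, (count (fun i => `[< F i x >]) s <= K)%N) ->
  \sum_(i <- s) pr (F i) <= K%:R.
Proof.
move=> mF FK; rewrite -lee_fin -sumEFin.
have -> : (\sum_(i <- s) (pr (F i))%:E = \int[P]_x \sum_(i <- s) (\1_(F i) x)%:E)%E.
  rewrite ge0_integral_sum //; last first.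
    by move=> i; apply/measurable_EFinP/measurable_indic.
  by apply: eq_bigr => i _; rewrite integral_indic // setIT -prE.
have -> : (K%:R%:E = \int[P]_(x in setT) (cst K%:R%:E x) :> \bar R)%E.
  rewrite integral_cst // -[LHS]mule1; congr (_ * _)%E.
  exact/esym/probability_setT.
apply: ge0_le_integral => //.
- by move=> x _; apply: sume_ge0.
- by apply: emeasurable_sum => i; apply/measurable_EFinP/measurable_indic.
- move=> x _; rewrite sumEFin lee_fin.
  have -> : \sum_(i <- s) \1_(F i) x = (count (fun i => `[< F i x >]) s)%:R :> R.
    by rewrite -sum1_count natr_sum [RHS]big_mkcond /=; apply: eq_bigr => i _;
       rewrite indicE; case: asboolP => [Fx|nFx]; rewrite ?(mem_set Fx) ?(memNset nFx).
  by rewrite ler_nat.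
Qed.

Definition discrete_rv U := forall S : set G, measurable (U @^-1` S).

Definition indep_rv U V := forall S T : set G,
  pr (U @^-1` S `&` V @^-1` T) = pr (U @^-1` S) * pr (V @^-1` T).

Lemma measurable_discrete_rv2 U V (S : G -> G -> Prop) :
  discrete_rv U -> discrete_rv V -> measurable [set x | S (U x) (V x)].
Proof.
move=> mU mV; have /countable_injP[c c_inj] := G_countable.
have -> : [set x | S (U x) (V x)] = \bigcup_k
    (U @^-1` [set g | c g = k] `&` V @^-1` [set h | exists2 g, c g = k & S g h]).
  apply/seteqP; split=> [x Sx|x [k _ [/= Uk [g gk Sg]]]] /=.
    by exists (c (U x)) => //; split => //=; exists (U x).
  by rewrite (c_inj (U x) g) ?inE // Uk gk.
by apply: bigcupT_measurable => k; exact: measurableI.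
Qed.

(** Lets finite sums over [E] stand for the countable sums over the values of [U]. *)
Lemma pr_tight U (eps : R) : discrete_rv U -> 0 < eps ->
  exists2 E : seq G, uniq E & pr (U @^-1` (~` [set` E])) <= eps.
Proof.
move=> mU eps0; have /countable_injP[c c_inj] := G_countable.
pose B n := U @^-1` [set g | (c g < n)%N].
have B_cvg : (P \o B) n @[n --> \oo] --> P (\bigcup_n B n).
  apply: nondecreasing_cvg_mu; first by move=> n; exact: mU.
    by apply: bigcupT_measurable => n; exact: mU.
  by move=> m n mn; apply/subsetPset => x /= cm; exact: leq_trans cm mn.
have BT : \bigcup_n B n = setT.
  by apply/seteqP; split=> // x _; exists (c (U x)).+1 => //; exact: ltnSn.
have [n Bn] : exists n, pr (~` B n) <= eps.
  move: B_cvg; rewrite BT probability_setT => /fine_cvgP[_].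
  move=> /cvgrPdist_le/(_ _ eps0)[n _ Bn]; exists n.
  have := Bn n (leqnn n); rewrite prC; last exact: mU.
  by move=> /=; apply: le_trans; exact: ler_norm.
have /finite_seqP[s cs] : finite_set [set g | (c g < n)%N].
  apply: (@finite_preimage _ _ `I_n) => //.
  by move=> g h _ _; apply: c_inj; rewrite inE.
exists (undup s); first exact: undup_uniq.
apply: le_trans Bn; apply: le_pr; first exact: mU.
  exact/measurableC/mU.
move=> x /= + cn; apply; rewrite mem_undup.
have : [set g | (c g < n)%N] (U x) by [].
by rewrite cs.
Qed.

(** The law of total probability for the values of [V] in [E], with an error term for
    the others. *)
Lemma pr_condition U V (S : G -> set G) (E : seq G) :
  discrete_rv U -> discrete_rv V -> indep_rv V U ->
  pr [set x | S (V x) (U x)] <=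
    \sum_(g <- E) pr (V @^-1` [set g]) * pr (U @^-1` S g) + pr (V @^-1` (~` [set` E])).
Proof.
move=> mU mV VU; set F := fun g => V @^-1` [set g] `&` U @^-1` S g.
have mF g : measurable (F g) by apply: measurableI.
have mFE : measurable (\big[setU/set0]_(g <- E) F g) by apply: bigsetU_measurable.
apply: (@le_trans _ _ (pr (\big[setU/set0]_(g <- E) F g `|` V @^-1` (~` [set` E])))).
  apply: le_pr; first exact: (measurable_discrete_rv2 S mV mU).
    by apply: measurableU; [exact: mFE|exact: mV].
  move=> x Sx; have [VE|VE] := boolP (V x \in E); last by right; exact/negP.
  by left; rewrite -bigcup_seq; exists (V x).
apply: le_trans (prU _ _) _ => //.
rewrite lerD2r; under [leRHS]eq_bigr do rewrite -VU.
exact: pr_bigU.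
Qed.

Lemma pr_point_sum U (E : seq G) : discrete_rv U -> uniq E ->
  \sum_(g <- E) pr (U @^-1` [set g]) <= 1.
Proof.
move=> mU uE; apply: (pr_multiplicity (K := 1)) => [g|x]; first exact: mU.
rewrite (@eq_count _ _ (pred1 (U x))) ?count_uniq_mem ?leq_b1 // => g /=.
by apply/asboolP/eqP => [->|].
Qed.

Lemma pr_condition_le U V (S : G -> set G) (eps : R) :
  discrete_rv U -> discrete_rv V -> indep_rv V U ->
  (forall g, pr (U @^-1` S g) <= eps) -> pr [set x | S (V x) (U x)] <= eps.
Proof.
move=> mU mV VU Seps; apply/ler_addgt0Pr => e e0.
have [E uE tE] := pr_tight mV e0.
have eps0 : 0 <= eps.
  have [x _] : [set: Omega] !=set0.
    apply/set0P/negP => /eqP T0; have := probability_setT P.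
    by rewrite T0 measure0 => /eqP; rewrite eqe eq_sym oner_eq0.
  exact: le_trans (pr_ge0 _) (Seps (V x)).
apply: le_trans (pr_condition S E mU mV VU) _; apply: lerD => //.
apply: (@le_trans _ _ (\sum_(g <- E) pr (V @^-1` [set g]) * eps)).
  by apply: ler_sum => g _; rewrite ler_wpM2l // pr_ge0.
by rewrite -mulr_suml ler_piMl // pr_point_sum.
Qed.

End CountableProbability.

(** * Anticoncentration of convolution powers *)

Lemma pos_lower_bound {R : realType} (T : eqType) (s : seq T) (f : T -> R) :
  {in s, forall x, 0 < f x} -> exists2 c, 0 < c & {in s, forall x, c <= f x}.
Proof.
elim: s => [|x s IH] f0; first by exists 1.
have [c c0 cf] : exists2 c, 0 < c & {in s, forall x, c <= f x}.
  by apply: IH => y ys; apply: f0; rewrite inE ys orbT.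
exists (Num.min c (f x)); first by rewrite lt_min c0 f0 ?mem_head.
move=> y; rewrite inE ge_min => /orP[/eqP ->|/cf ->] //.
by rewrite lexx orbT.
Qed.

Lemma sumr_const_seq {R : pzRingType} (T : Type) (s : seq T) (c : R) :
  \sum_(x <- s) c = c *+ size s.
Proof. by rewrite big_const_seq count_predT iter_addr_0. Qed.

Lemma seq_upper_bound (T : eqType) (s : seq T) (f : T -> nat) :
  exists D, {in s, forall x, (f x <= D)%N}.
Proof.
by exists (\max_(x <- s) f x)%N => x xs; apply: leq_bigmax_seq.
Qed.

Section Anticoncentration.
Context {R : realType} {G : groupType} {d : measure_display} {Omega : measurableType d}.
Variable P : probability Omega R.
Hypothesis G_countable : countable [set: G].
Local Notation pr := (prob P).

Variable u : nat -> Omega -> G.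
Hypothesis u_rv : forall n, discrete_rv (u n).

(** The law of [u (m + n)] is the convolution of those of [u m] and [u n]; the
    law of [u m] is truncated to a finite set to have finite sums only. *)
Definition convolution_powers := forall m n (E : seq G) (A : set G),
  pr (u (m + n)%N @^-1` A) <=
    \sum_(g <- E) pr (u m @^-1` [set g]) * pr (u n @^-1` [set x | A (g * x)%g])
      + pr (u m @^-1` (~` [set` E])).

Hypothesis u_conv : convolution_powers.

Variables (B : Type) (S : nat -> B -> set G).
Hypothesis S_decr : forall L L' b, (L <= L')%N -> S L' b `<=` S L b.
Hypothesis S_shift : forall g, exists D, forall L b, exists b',
  forall x, S (L + D)%N b (g * x)%g -> S L b' x.

(** Bounds for all sets of the class at once, at late times and at some depth [L]. *)
Definition eventual_bound (t : R) := 0 <= t /\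
  exists L N, forall n b, (N <= n)%N -> pr (u n @^-1` S L b) <= t.

(** One step of the recursion: the first factor is in [F] with a definite
    probability, and the translates by the inverses of elements of [F]
    share a total mass of at most 2 instead of [size F * t]. *)
Lemma eventual_bound_step m (F : seq G) L0 c t e :
  uniq F -> 0 <= c -> {in F, forall s, c <= pr (u m @^-1` [set s])} ->
  (forall L b x, (L0 <= L)%N -> (count (fun s => `[< S L b (s * x)%g >]) F <= 2)%N) ->
  0 < e -> eventual_bound t -> eventual_bound (e + 2 * c + (1 - c * (size F)%:R) * t).
Proof.
move=> uF c0 cF multF e0 [t0 [L1 [N1 tL]]].
have cF1 : c * (size F)%:R <= 1.
  apply: le_trans (pr_point_sum P (u_rv m) uF).
  rewrite mulr_natr -sumr_const_seq big_seq [leRHS]big_seq.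
  by apply: ler_sum => s sF; exact: cF.
split; first by rewrite !addr_ge0 ?mulr_ge0 ?subr_ge0 // ltW.
have [E0 uE0 tE0] := pr_tight P G_countable (u_rv m) e0.
pose E1 := [seq g <- E0 | g \notin F].
have uE : uniq (F ++ E1).
  rewrite cat_uniq uF filter_uniq // andbT /=; apply/hasPn => g.
  by rewrite mem_filter => /andP[].
have tE : pr (u m @^-1` (~` [set` F ++ E1])) <= e.
  apply: le_trans tE0; apply: le_pr; try exact: u_rv.
  move=> x /= nE xE; apply: nE; rewrite mem_cat mem_filter xE andbT.
  exact: orbN.
have /choice[D DS] := S_shift.
have [D1 DE] := seq_upper_bound (F ++ E1) D.
exists (maxn L0 L1 + D1)%N, (m + N1)%N => n b Nn.
have mn : (m <= n)%N by apply: leq_trans Nn; exact: leq_addr.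
have Nm : (N1 <= n - m)%N by rewrite leq_subRL.
rewrite -(subnKC mn).
pose q g := pr (u (n - m)%N @^-1` [set x | S (maxn L0 L1 + D1)%N b (g * x)%g]).
pose p g := pr (u m @^-1` [set g]).
apply: le_trans (u_conv m (n - m)%N (F ++ E1) _) _.
rewrite -addrA addrC; apply: lerD => //.
have qt g : g \in F ++ E1 -> q g <= t.
  move=> gE; have [b' bS] := DS g (L1 + (D1 - D g))%N b.
  apply: le_trans (tL _ b' Nm); apply: le_pr; try exact: u_rv.
  move=> x /= Sx; apply: (S_decr (L' := (L1 + (D1 - D g))%N)); first exact: leq_addr.
  apply: bS; apply: S_decr Sx; rewrite -addnA subnK ?DE //.
  by rewrite leq_add2r leq_maxr.
have qF : \sum_(s <- F) q s <= 2.
  apply: pr_multiplicity => [s|x]; first exact: u_rv.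
  by apply: multF; rewrite (leq_trans (leq_maxl L0 L1)) ?leq_addr.
have sum_p : \sum_(g <- F) p g + \sum_(g <- E1) p g <= 1.
  by rewrite -big_cat; exact: pr_point_sum.
rewrite big_cat /= -/p -/q.
have hF : \sum_(g <- F) p g * q g <= (\sum_(g <- F) p g - c * (size F)%:R) * t + 2 * c.
  apply: (@le_trans _ _ (\sum_(g <- F) ((p g - c) * t + c * q g))).
    rewrite big_seq [leRHS]big_seq; apply: ler_sum => g gF.
    have : (p g - c) * q g <= (p g - c) * t.
      by rewrite ler_wpM2l ?subr_ge0 ?cF // qt // mem_cat gF.
    rewrite mulrBl; lra.
  rewrite big_split /= -mulr_suml -mulr_sumr sumrB sumr_const_seq mulr_natr lerD2l.
  by rewrite mulrC ler_wpM2r.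
have hE : \sum_(g <- E1) p g * q g <= (\sum_(g <- E1) p g) * t.
  rewrite mulr_suml big_seq [leRHS]big_seq; apply: ler_sum => g gE.
  by rewrite ler_wpM2l ?pr_ge0 // qt // mem_cat gE orbT.
have hp := ler_wpM2r t0 sum_p.
apply: le_trans (lerD hF hE) _; move: hp; clear; lra.
Qed.

Hypothesis S_mult : forall M, exists m F L0,
  [/\ size F = M, uniq F, {in F, forall s, 0 < pr (u m @^-1` [set s])}
    & forall L b x, (L0 <= L)%N -> (count (fun s => `[< S L b (s * x)%g >]) F <= 2)%N].

(** Iterating the step brings the bounds down to [2 / M], and [M] is arbitrary. *)
Lemma anticoncentration eps : 0 < eps -> exists L N,
  forall n b, (N <= n)%N -> pr (u n @^-1` S L b) <= eps.
Proof.
move=> eps0; pose T := [set t | eventual_bound t].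
have T1 : T 1.
  by split=> //; exists 0%N, 0%N => n b _; apply: pr_le1; exact: u_rv.
have infT : has_inf T by split; [exists 1|exists 0 => t []].
(* In the limit, the step gives [t <= 2 c + (1 - c M) t] for [t = inf T]. *)
have [M HM] := natr_above (2 / eps + 1).
have [m [F [L0 [sF uF pF multF]]]] := S_mult M.
have [c c0 cF] := pos_lower_bound pF.
have Tinf e : 0 < e -> inf T <= e + 2 * c + (1 - c * M%:R) * (inf T + e).
  move=> e0; have [t Tt lt] := inf_adherent e0 infT.
  have Tt' := eventual_bound_step uF (ltW c0) cF multF e0 Tt.
  rewrite sF in Tt'; apply: (le_trans (ge_inf infT.2 Tt')).
  rewrite lerD2l; apply: ler_wpM2l; last exact: ltW.
  rewrite subr_ge0.
  apply: le_trans (pr_point_sum P (u_rv m) uF).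
  rewrite mulr_natr -sF -sumr_const_seq big_seq [leRHS]big_seq.
  by apply: ler_sum => s sF'; exact: cF.
have infT0 : 0 <= inf T by apply: lb_le_inf; [exists 1|move=> t []].
have Minf : M%:R * inf T <= 2.
  apply/ler_addgt0Pr => e e0.
  have e1 : 0 < e * c / 2 by rewrite divr_gt0 // mulr_gt0.
  have := Tinf _ e1.
  have : 0 <= c * M%:R * (e * c / 2) by rewrite !mulr_ge0 // ltW.
  move=> h1 h2; rewrite -(ler_pM2l c0).
  have {h2} h3 : c * M%:R * inf T <= e * c / 2 + 2 * c + e * c / 2 - c * M%:R * (e * c / 2).
    by move: h2; rewrite mulrBl mul1r !mulrDr; lra.
  rewrite mulrA; lra.
have inf_eps : inf T < eps.
  rewrite ltNge; apply/negP => eps_inf.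
  have : (2 / eps + 1) * eps <= M%:R * inf T.
    apply: ler_pM => //; last exact: ltW.
    by rewrite addr_ge0 // divr_ge0 // ltW.
  rewrite mulrDl divfK ?gt_eqF //; lra.
have [t [_ [L [N tL]]] teps] := inf_lt infT.1 inf_eps.
by exists L, N => n b Nn; apply: le_trans (tL n b Nn) (ltW teps).
Qed.

End Anticoncentration.

(** * Independence of the blocks of a random walk *)

Lemma discrete_rvM {R : realType} {G : groupType} {d : measure_display}
    {Omega : measurableType d} (U V : Omega -> G) :
  countable [set: G] -> discrete_rv U -> discrete_rv V ->
  discrete_rv (fun x => U x * V x)%g.
Proof.
move=> cG mU mV S.
exact: (measurable_discrete_rv2 cG (fun g h => S (g * h)%g) mU mV).
Qed.

Section BlockIndependence.
Context {R : realType} {G : groupType} {d : measure_display} {Omega : measurableType d}.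
Variables (mu : probability (discrete G) R) (P : probability Omega R).
Variable code : G -> nat.
Hypothesis code_inj : injective code.
Variable g : nat -> {RV P >-> discrete G}.
Hypothesis g_law : forall i A, distribution P (g i) A = mu A.
Hypothesis g_indep : mutually_independent P (fun i => g_sigma_algebra_preimage (g i)).

Let G_countable : countable [set: G].
Proof. by apply/countable_injP; exists code => a b _ _; exact: code_inj. Qed.

Definition fiber k : set G := [set a | code a = k].

Lemma fiberE a : fiber (code a) = [set a].
Proof. by apply/seteqP; split=> b /= => [/code_inj|->]. Qed.

(** The [n]-fold convolution power of [mu], by conditioning on the first factor;
    a sum over the codes of elements instead of over the elements. *)
Fixpoint convolution_power n (A : set G) : \bar R :=
  if n is n'.+1 then
    (\sum_(0 <= k <oo) mu (fiber k) *
       convolution_power n' [set x | exists2 a, fiber k a & A (a * x)%g])%E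
  else (\1_A 1%g)%:E.

Lemma convolution_power_ge0 n A : (0 <= convolution_power n A)%E.
Proof.
elim: n A => [|n IH] A /=; first by rewrite lee_fin indicE.
by apply: nneseries_ge0 => k _ _; apply: mule_ge0.
Qed.

Definition block m n (x : Omega) : G := (\prod_(m <= i < m + n) (g i x : G))%g.

Lemma increment_rv i : discrete_rv (fun x => g i x : G).
Proof. by move=> A; rewrite -[X in measurable X]setTI; exact: measurable_funPT. Qed.

Lemma block0 m x : block m 0 x = 1%g.
Proof. by rewrite /block addn0 big_geq. Qed.

Lemma blockS m n x : block m n.+1 x = (g m x * block m.+1 n x)%g.
Proof. by rewrite /block big_ltn ?addSnnS // addnS ltnS leq_addr. Qed.

Lemma block_rv m n : discrete_rv (block m n).
Proof.
elim: n m => [|n IH] m.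
  move=> A; have -> : block m 0 = fun=> 1%g by apply/funext => x; exact: block0.
  by rewrite preimage_cst; case: ifP => _; [exact: measurableT|exact: measurable0].
have -> : block m n.+1 = fun x => (g m x * block m.+1 n x)%g.
  by apply/funext => x; exact: blockS.
by apply: discrete_rvM => //; exact: increment_rv.
Qed.

Definition past m (E : set Omega) := exists A : nat -> set G,
  E = \bigcap_(i in [set` iota 0 m]) (fun x => g i x : G) @^-1` A i.

Lemma past_measurable m E : past m E -> measurable E.
Proof.
move=> [A ->]; apply: fin_bigcap_measurable; first exact: finite_seq.
by move=> i _; exact: increment_rv.
Qed.

Lemma past_prob m (A : nat -> set G) :
  P (\bigcap_(i in [set` iota 0 m]) (fun x => g i x : G) @^-1` A i) =
    (\prod_(i <- iota 0 m) mu (A i))%E.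
Proof.
rewrite g_indep ?iota_uniq //; first by apply: eq_bigr => i _; rewrite -(g_law i).
by move=> i _; exists (A i) => //; rewrite setTI.
Qed.

Lemma past_extend m E B : past m E -> past m.+1 (E `&` (fun x => g m x : G) @^-1` B) /\
  P (E `&` (fun x => g m x : G) @^-1` B) = (P E * mu B)%E.
Proof.
move=> [A EA]; pose A' i := if (i < m)%N then A i else B.
have E' : E `&` (fun x => g m x : G) @^-1` B =
    \bigcap_(i in [set` iota 0 m.+1]) (fun x => g i x : G) @^-1` A' i.
  have mem_range n i : [set` iota 0 n] i <-> (i < n)%N by rewrite /= mem_iota.
  rewrite EA; apply/seteqP; split=> [x [h hB] i /mem_range|x h].
    rewrite ltnS leq_eqVlt /A' => /orP[/eqP ->|im]; rewrite ?ltnn ?im //.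
    exact/h/mem_range.
  split=> [i /mem_range im|].
    by have := h i; rewrite /A' im; apply; apply/mem_range; rewrite ltnW.
  by have := h m; rewrite /A' ltnn; apply; exact/mem_range.
have pE' : past m.+1 (E `&` (fun x => g m x : G) @^-1` B) by exists A'.
split=> //; rewrite E' EA !past_prob.
rewrite -addn1 iotaD big_cat /= big_seq1 add0n /A' ltnn; congr (_ * _)%E.
by apply: eq_big_seq => i; rewrite mem_iota add0n /= => ->.
Qed.

(** The engine of the inductions on the length of a block: it strips off the first
    increment, which joins the past [E]. *)
Lemma condition_on_increment m E (S : G -> Omega -> Prop) (l : nat -> \bar R) :
  past m E -> measurable [set x | S (g m x) x] -> (forall k, 0 <= l k)%E ->
  (forall a, P (E `&` (fun x => g m x : G) @^-1` [set a] `&` [set x | S a x]) =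
     (P (E `&` (fun x => g m x : G) @^-1` [set a]) * l (code a))%E) ->
  P (E `&` [set x | S (g m x) x]) =
    (P E * \sum_(0 <= k <oo) (mu (fiber k) * l k))%E.
Proof.
move=> pE mS l0 Sl.
pose F k := E `&` (fun x => g m x : G) @^-1` fiber k `&` [set x | S (g m x) x].
have mF k : measurable (F k).
  by apply: measurableI => //; apply: measurableI; [exact: past_measurable pE|exact: increment_rv].
have -> : E `&` [set x | S (g m x) x] = \bigcup_k F k.
  apply/seteqP; split=> [x [Ex Sx]|x [k _ [[Ex _] Sx]]] //.
  by exists (code (g m x)).
rewrite measure_bigcup //; last first.
  by move=> i j _ _ [x [[[_ /= <-] _] [[_ /= <-] _]]].
rewrite (eq_eseriesr (g := fun k => (P E * (mu (fiber k) * l k))%E)); last first.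
  move=> k _; have [[a ak]|nk] := pselect (exists a, code a = k).
    rewrite /F -ak fiberE muleA -(past_extend [set a] pE).2 -Sl; congr (P _).
    by apply/seteqP; split=> x [[Ex ga] Sx]; split=> //; move: Sx; rewrite /= ga.
  have -> : F k = set0.
    by apply/seteqP; split=> // x [[_ /= gk] _]; apply: nk; exists (g m x).
  have -> : fiber k = set0 by apply/seteqP; split=> // a ak; apply: nk; exists a.
  by rewrite !measure0 mul0e mule0.
rewrite (eq_eseriesl (Q := xpredT)); last by move=> k /=; rewrite in_setT.
by rewrite (prE P (past_measurable pE)) nneseriesZl // => k _; apply: mule_ge0.
Qed.

Lemma fiber_translate a (A : set G) :
  [set x | exists2 b, fiber (code a) b & A (b * x)%g] = [set x | A (a * x)%g].
Proof. by rewrite fiberE; apply/seteqP; split=> [x [b -> //]|x ?]; exists a. Qed.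

Lemma past_block m n E A : past m E ->
  P (E `&` block m n @^-1` A) = (P E * convolution_power n A)%E.
Proof.
elim: n m E A => [|n IH] m E A pE /=.
  have -> : block m 0 = fun=> 1%g by apply/funext => x; exact: block0.
  rewrite preimage_cst indicE; case: ifP => _; first by rewrite setIT mule1.
  by rewrite setI0 measure0 mule0.
have -> : block m n.+1 @^-1` A = [set x | A (g m x * block m.+1 n x)%g].
  by apply/seteqP; split=> x; rewrite /= blockS.
apply: (condition_on_increment (S := fun a x => A (a * block m.+1 n x)%g)) => //.
- exact: (discrete_rvM G_countable (increment_rv m) (block_rv m.+1 n)).
- by move=> k; exact: convolution_power_ge0.
- move=> a; rewrite fiber_translate.
  exact: (IH m.+1 _ [set x | A (a * x)%g] (past_extend [set a] pE).1).
Qed.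

Lemma block_law m n A : P (block m n @^-1` A) = convolution_power n A.
Proof.
have past_T : past m setT by exists (fun=> setT); apply/seteqP; split.
by have := past_block n A past_T; rewrite setTI probability_setT mul1e.
Qed.

Lemma past_block2 m n1 n2 E A B : past m E ->
  P (E `&` block m n1 @^-1` A `&` block (m + n1) n2 @^-1` B) =
    (P E * (convolution_power n1 A * convolution_power n2 B))%E.
Proof.
elim: n1 m E A => [|n IH] m E A pE /=.
  have -> : block m 0 = fun=> 1%g by apply/funext => x; exact: block0.
  rewrite preimage_cst indicE addn0; case: ifP => _.
    by rewrite setIT mul1e past_block.
  by rewrite setI0 set0I measure0 mul0e mule0.
have -> : E `&` block m n.+1 @^-1` A `&` block (m + n.+1) n2 @^-1` B =
  E `&` [set x | A (g m x * block m.+1 n x)%g /\ B (block (m.+1 + n) n2 x)].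
  rewrite addSnnS -setIA; congr (_ `&` _).
  by apply/seteqP; split=> x /=; rewrite blockS.
rewrite (condition_on_increment (S := fun a x => A (a * block m.+1 n x)%g /\ B (block (m.+1 + n) n2 x))
  (l := fun k => (convolution_power n [set x | exists2 a, fiber k a & A (a * x)%g]
          * convolution_power n2 B)%E)) //.
- congr (_ * _)%E.
  rewrite -[convolution_power n2 B](block_law 0) (prE P (block_rv 0 n2 B)).
  under eq_eseriesr do rewrite muleA muleC.
  rewrite nneseriesZl; first by rewrite muleC.
  by move=> k _; apply: mule_ge0 => //; exact: convolution_power_ge0.
- apply: (@measurableI _ _ [set x | A (g m x * block m.+1 n x)%g]).
    exact: (discrete_rvM G_countable (increment_rv m) (block_rv m.+1 n)).
  exact: block_rv.
- by move=> k; apply: mule_ge0; exact: convolution_power_ge0.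
- move=> a; rewrite fiber_translate.
  rewrite -(IH m.+1 _ [set x | A (a * x)%g] (past_extend [set a] pE).1) setIA //.
Qed.

End BlockIndependence.

Section RandomWalk.
Context {R : realType} {G : groupType} {d : measure_display} {Omega : measurableType d}.
Variables (mu : probability (discrete G) R) (P : probability Omega R).
Hypothesis G_countable : countable [set: G].
Variable w : nat -> Omega -> G.
Hypothesis w_walk : random_walk mu P w.
Local Notation pr := (prob P).

Definition walk_increment m n (x : Omega) : G := ((w m x)^-1 * w (m + n)%N x)%g.

Lemma random_walk_blocks : exists g : nat -> {RV P >-> discrete G},
  [/\ (forall n, w n = block g 0 n) /\ (forall m n, walk_increment m n = block g m n),
      forall m n, discrete_rv (block g m n),
      forall m n (A : set G), pr (block g m n @^-1` A) = pr (w n @^-1` A),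
      forall m n (A B : set G), pr (block g 0 m @^-1` A `&` block g m n @^-1` B) =
        pr (w m @^-1` A) * pr (w n @^-1` B)
    & forall a : G, pr (w 1 @^-1` [set a]) = fine (mu [set a])].
Proof.
have /countable_injP[code code_inj'] := G_countable.
have code_inj : injective code by move=> a b; apply: code_inj'; rewrite inE.
have [g [g_law g_indep w_prod]] := w_walk.
have wE n : w n = block g 0 n.
  by apply/funext => x; rewrite w_prod /block add0n big_mkord.
have rv := block_rv code_inj g.
have law m n A := block_law code_inj g_law g_indep m n A.
have T0 : past g 0 setT by exists (fun=> setT); apply/seteqP; split.
exists g; split=> //.
- split=> // m n; apply/funext => x; rewrite /walk_increment !wE /block !add0n.
  by rewrite [X in (_ * X)%g](big_cat_nat (n := m)) ?leq_addr //= mulKg.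
- by move=> m n A; rewrite wE /prob !law.
- move=> m n A B; rewrite !wE; apply: EFin_inj; rewrite EFinM.
  rewrite -(prE P (measurableI _ _ (rv 0%N m A) (rv m n B))) -!(prE P (rv _ _ _)).
  have := past_block2 code_inj g_law g_indep m n A B T0.
  by rewrite setTI probability_setT mul1e add0n !law.
- move=> a; rewrite /prob wE -(g_law 0%N); congr (fine (P _)).
  by apply/seteqP; split=> x; rewrite /= /block add0n big_nat1.
Qed.

Lemma walk_rv n : discrete_rv (w n).
Proof. by have [g [[wE _] rv _ _ _]] := random_walk_blocks; rewrite wE; exact: rv. Qed.

Lemma walk_increment_rv m n : discrete_rv (walk_increment m n).
Proof. by have [g [[_ incE] rv _ _ _]] := random_walk_blocks; rewrite incE; exact: rv. Qed.

Lemma walk_increment_law m n (A : set G) :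
  pr (walk_increment m n @^-1` A) = pr (w n @^-1` A).
Proof. by have [g [[_ incE] _ law _ _]] := random_walk_blocks; rewrite incE law. Qed.

Lemma walk_increment_indep m n : indep_rv P (w m) (walk_increment m n).
Proof.
move=> A B; rewrite walk_increment_law.
by have [g [[wE incE] _ _ indep _]] := random_walk_blocks; rewrite incE {1}wE indep.
Qed.

Lemma walk_convolution : convolution_powers P w.
Proof.
move=> m n E A.
have -> : w (m + n)%N @^-1` A = [set x | A (w m x * walk_increment m n x)%g].
  by apply/seteqP; split=> x /=; rewrite mulVKg.
under eq_bigr do rewrite -(walk_increment_law m n).
apply: (pr_condition G_countable (fun g => [set x | A (g * x)%g])) => //.
- exact: walk_increment_rv.
- exact: walk_rv.
- exact: walk_increment_indep.
Qed.

(** The inverse of a walk is a product of inverse increments, in the reversed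
    order; its first factor is thus the inverse of the last block. *)
Lemma inverse_walk_convolution : convolution_powers P (fun n x => (w n x)^-1%g).
Proof.
move=> m n E A; rewrite addnC.
have -> : (fun x => (w (n + m)%N x)^-1)%g @^-1` A =
    [set x | A ((walk_increment n m x)^-1 * (w n x)^-1)%g].
  by apply/seteqP; split=> x /=; rewrite -invgM mulVKg.
have law (B : set G) : pr ((fun x => (w m x)^-1)%g @^-1` B) =
    pr ((fun x => (walk_increment n m x)^-1)%g @^-1` B).
  exact: esym (walk_increment_law n m [set x | B x^-1%g]).
under eq_bigr do rewrite law.
rewrite law; apply: (pr_condition G_countable (fun g => [set x | A (g * x)%g])) => //.
- by move=> B; exact: (walk_rv n [set x | B x^-1%g]).
- by move=> B; exact: (walk_increment_rv n m [set x | B x^-1%g]).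
- move=> B C; rewrite setIC mulrC.
  exact: (walk_increment_indep n m [set x | C x^-1%g] [set x | B x^-1%g]).
Qed.

Definition reachable n (a : G) := 0 < pr (w n @^-1` [set a]).

Lemma reachable0 : reachable 0 1%g.
Proof.
rewrite /reachable (_ : w 0 @^-1` _ = setT) ?/prob ?probability_setT //.
have [g [[wE _] _ _ _ _]] := random_walk_blocks.
by apply/seteqP; split=> x //= _; rewrite wE block0.
Qed.

Lemma reachableM m n a b : reachable m a -> reachable n b -> reachable (m + n)%N (a * b)%g.
Proof.
rewrite /reachable -(walk_increment_law m n) => a0 b0.
apply: lt_le_trans (mulr_gt0 a0 b0) _; rewrite -walk_increment_indep.
apply: le_pr; last by move=> x [/= <- <-]; rewrite mulVKg.
  by apply: measurableI; [exact: walk_rv|exact: walk_increment_rv].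
exact: walk_rv.
Qed.

Lemma reachable_semigroup a : generated_semigroup (Defs.support mu) a -> exists n, reachable n a.
Proof.
move=> /(_ [set b | exists n, reachable n b]); apply; split=> [b c|b].
  rewrite !inE /= => -[m rb] [n rc]; exists (m + n)%N; exact: reachableM.
rewrite /Defs.support /= => b0; exists 1%N; rewrite /reachable.
have [g [_ _ _ _ step]] := random_walk_blocks; rewrite step.
by rewrite fine_gt0 // b0 /= ltey_eq fin_num_measure.
Qed.

End RandomWalk.

(** * Random walks escape, and avoid every fixed direction *)

Section Escape.
Context {R : realType} {G : groupType} {X : metricType R}.
Variables (act : G -> X -> X) (act_isom : isometric_action act).
Variable delta : R.
Hypothesis hyp : forall x y z w : X,
  Num.min (gromov_product w x z) (gromov_product w z y) - delta <= gromov_product w x y.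
Variable o : X.

Local Notation gp := (@gromov_product R X).
Local Notation "`[ g ]" := (displacement act o g) (format "`[ g ]").

Context {d : measure_display} {Omega : measurableType d}.
Variable P : probability Omega R.
Hypothesis G_countable : countable [set: G].
Local Notation pr := (prob P).

Definition escapes (u : nat -> Omega -> G) := forall rho eps : R, 0 < eps ->
  exists N, forall n, (N <= n)%N -> pr (u n @^-1` [set g | `[g] <= rho]) <= eps.

Definition avoids_directions (u : nat -> Omega -> G) := forall eps : R, 0 < eps ->
  exists (L : nat) N, forall n b, (N <= n)%N ->
    pr (u n @^-1` [set g | L%:R <= gp o (act g o) b]) <= eps.

Section ConvolutionPowers.
Variable u : nat -> Omega -> G.
Hypothesis u_rv : forall n, discrete_rv (u n).
Hypothesis u_conv : convolution_powers P u.
Hypothesis u_schottky : forall M r, exists m C F,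
  [/\ size F = M, schottky act o C r F & forall s, s \in F -> 0 < pr (u m @^-1` [set s])].

Lemma convolution_powers_escape : escapes u.
Proof.
move=> rho eps eps0.
suff [L [N HN]] : exists (L : nat) N, forall n b, (N <= n)%N ->
    pr (u n @^-1` [set g | mdist (act g o) b <= rho]) <= eps.
  exists N => n Nn; rewrite /displacement.
  have -> : [set g | mdist o (act g o) <= rho] = [set g | mdist (act g o) o <= rho].
    by apply/seteqP; split=> g /=; rewrite metric_sym.
  exact: HN.
apply: (anticoncentration G_countable u_rv u_conv
  (S := fun _ b => [set g | mdist (act g o) b <= rho])) => //.
- by move=> L L' b _ g.
- move=> g; exists 0%N => _ b; exists (act g^-1%g b) => x /=.
  by rewrite isometric_actM // mdist_actl.
- move=> M; have [m [C [F [sF schF pF]]]] := u_schottky M (2 * delta + rho + 1).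
  exists m, F, 0%N; split=> //; first by case: schF.
  move=> _ b x _; rewrite (eq_count (a2 := fun s => mdist (act s (act x o)) b <= rho)).
    by apply: (schottky_ball_count act_isom hyp (act x o) b schF); lra.
  by move=> s /=; rewrite asboolb isometric_actM.
Qed.

Lemma convolution_powers_avoid_directions : avoids_directions u.
Proof.
move=> eps eps0.
apply: (anticoncentration G_countable u_rv u_conv
  (S := fun L b => [set g | L%:R <= gp o (act g o) b])) => //.
- by move=> L L' b LL' g /=; apply: le_trans; rewrite ler_nat.
- move=> g; have [D HD] := natr_above `[g]; exists D => L b.
  exists (act g^-1%g b) => x /=; rewrite isometric_actM // natrD.
  have -> : gp o (act g (act x o)) b = gp (act g^-1%g o) (act x o) (act g^-1%g b).
    by rewrite gromov_product_actl // invgK isometric_actKV.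
  have := gromov_product_rebased o (act g^-1%g o) (act x o) (act g^-1%g b).
  rewrite -/(displacement _ _ _) displacementV //; lra.
- move=> M; have [m [C [F [sF schF pF]]]] := u_schottky M (3 * delta + 1).
  have [L0 HL0] := natr_above (C + (3 * delta + 1) - delta).
  exists m, F, L0; split=> //; first by case: schF.
  move=> L b x LL0; rewrite (eq_count (a2 := fun s => L%:R <= gp o (act s (act x o)) b)).
    apply: (schottky_shadow_count act_isom hyp (act x o) b schF); first lra.
    by apply: le_trans HL0 _; rewrite ler_nat.
  by move=> s /=; rewrite asboolb isometric_actM.
Qed.

End ConvolutionPowers.

(** The non-backtracking condition of [chain_step] at [o], for the path that goes
    from [g o] to [o] and then to [h o]. *)
Definition antipodal g h :=
  `[g] + 2 * delta + 1 <= mdist (act g o) (act h o) /\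
  `[h] + 2 * delta + 1 <= mdist (act g o) (act h o).

Lemma antipodal_of_gromov_product L g h : gp o (act g o) (act h o) < L ->
  2 * L + 2 * delta + 1 < `[g] -> 2 * L + 2 * delta + 1 < `[h] -> antipodal g h.
Proof. by rewrite /antipodal /gromov_product /displacement; lra. Qed.

(** Without cancellation between [u] and [v], the point [u v o] lies in the direction
    of [u o] and [(u v)^-1 o] in the direction of [v^-1 o]; these directions differ. *)
Lemma antipodal_product_inverse L u v :
  gp o (act u o) (act v^-1%g o) < L -> gp o (act u^-1%g o) (act v o) < L ->
  2 * L + 6 * delta + 1 < `[u] -> 2 * L + 6 * delta + 1 < `[v] ->
  antipodal (u * v)%g (u * v)^-1%g.
Proof.
move=> uVv Vuv ubig vbig; set g := (u * v)%g.
have delta0 := hyperbolic_constant_ge0 hyp o.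
have gu : gp o (act u o) (act g o) = `[u] - gp o (act u^-1%g o) (act v o).
  have := gromov_product_side o (act u o) (act g o).
  by rewrite /g isometric_actM // (gromov_product_actl act_isom u) !isometric_actK // /displacement; lra.
have gv : gp o (act g^-1%g o) (act v^-1%g o) = `[v] - gp o (act u^-1%g o) (act v o).
  have := gromov_product_side o (act v^-1%g o) (act g^-1%g o).
  rewrite /g invgM isometric_actM // (gromov_product_actl act_isom v^-1%g).
  rewrite invgK !isometric_actKV // -/(displacement _ _ _) displacementV //.
  by rewrite (gromov_productC o (act v o)) (gromov_productC o (act v^-1%g o)); lra.
have ggV : gp o (act g o) (act g^-1%g o) < L + 2 * delta.
  rewrite ltNge; apply/negP => big.
  have h1 : L + 2 * delta <= gp o (act u o) (act g o) by rewrite gu; lra.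
  have h2 : L + 2 * delta - delta <= gp o (act g^-1%g o) (act v^-1%g o) by rewrite gv; lra.
  have := hyperbolicityP hyp (hyperbolicityP hyp h1 big) h2; lra.
have gbig : 2 * (L + 2 * delta) + 2 * delta + 1 < `[g].
  have : `[g] = `[u] + `[v] - 2 * gp o (act u^-1%g o) (act v o).
    rewrite /g /gromov_product mdist_orbit // invgK -!/(displacement _ _ _).
    by rewrite displacementV //; lra.
  lra.
by apply: (antipodal_of_gromov_product ggV gbig); rewrite displacementV.
Qed.

Lemma antipodal_rv (u v : Omega -> G) : discrete_rv u -> discrete_rv v ->
  measurable [set x | ~ antipodal (u x) (v x)].
Proof.
by move=> mu mv; apply: (measurable_discrete_rv2 G_countable (fun g h => ~ antipodal g h)).
Qed.

(** Conditionally on [v n], the variable [u n] still avoids the direction of [v n]. *)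
Lemma independent_antipodal (u v : nat -> Omega -> G) :
  (forall n, discrete_rv (u n)) -> (forall n, discrete_rv (v n)) ->
  (forall n, indep_rv P (v n) (u n)) -> escapes u -> escapes v -> avoids_directions u ->
  forall eps, 0 < eps -> exists N, forall n, (N <= n)%N ->
    pr [set x | ~ antipodal (u n x) (v n x)] <= eps.
Proof.
move=> mu mv uv escu escv diru eps eps0.
have e0 : 0 < eps / 3 by rewrite divr_gt0.
have [L [N1 HN1]] := diru _ e0.
have [N2 HN2] := escu (2 * L%:R + 2 * delta + 1) _ e0.
have [N3 HN3] := escv (2 * L%:R + 2 * delta + 1) _ e0.
exists (maxn N1 (maxn N2 N3)) => n; rewrite !geq_max => /and3P[n1 n2 n3].
pose B1 := [set x | L%:R <= gp o (act (u n x) o) (act (v n x) o)].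
have mB1 : measurable B1.
  exact: (measurable_discrete_rv2 G_countable
    (fun g h => L%:R <= gp o (act g o) (act h o)) (mu n) (mv n)).
have pB1 : pr B1 <= eps / 3.
  apply: (pr_condition_le G_countable
    (S := fun h => [set g | L%:R <= gp o (act g o) (act h o)]) (mu n) (mv n)) => // h.
  exact: HN1.
pose B2 := u n @^-1` [set g | `[g] <= 2 * L%:R + 2 * delta + 1].
pose B3 := v n @^-1` [set g | `[g] <= 2 * L%:R + 2 * delta + 1].
have mB2 : measurable B2 by exact: mu.
have mB3 : measurable B3 by exact: mv.
apply: (@le_trans _ _ (pr (B1 `|` (B2 `|` B3)))).
  apply: le_pr; [exact: antipodal_rv|by do 2?apply: measurableU|].
  move=> x /= nanti; apply: contrapT => /not_orP[/negP + /not_orP[/negP + /negP]].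
  rewrite -!ltNge => h1 h2 h3; apply: nanti.
  exact: antipodal_of_gromov_product h1 h2 h3.
have := prU P mB1 (measurableU _ _ mB2 mB3); have := prU P mB2 mB3.
have := HN2 n n2; have := HN3 n n3; rewrite -/B2 -/B3.
move: pB1; clear; lra.
Qed.

(** A walk and its own inverse are not independent, but the first half of the walk
    and the inverse of the second half are. *)
Lemma walk_inverse_antipodal (mu : probability (discrete G) R) (w : nat -> Omega -> G) :
  random_walk mu P w -> escapes w -> avoids_directions w ->
  forall eps, 0 < eps -> exists N, forall n, (N <= n)%N ->
    pr [set x | ~ antipodal (w n x) (w n x)^-1%g] <= eps.
Proof.
move=> w_walk escw dirw eps eps0.
have mw := walk_rv G_countable w_walk.
have e0 : 0 < eps / 4 by rewrite divr_gt0.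
have [L [N1 HN1]] := dirw _ e0.
have [N2 HN2] := escw (2 * L%:R + 6 * delta + 1) _ e0.
exists (maxn N1 N2).*2 => n Nn.
pose m := n./2; pose m' := (n - m)%N.
have [[m1 m1'] [m2 m2'] mm'] :
    [/\ (N1 <= m)%N /\ (N1 <= m')%N, (N2 <= m)%N /\ (N2 <= m')%N & (m + m' = n)%N].
  by rewrite /m' /m; split; lia.
pose u := w m; pose v := walk_increment w m m'.
have mu_ : discrete_rv u by exact: mw.
have mv : discrete_rv v by exact: (walk_increment_rv G_countable w_walk).
have uv : indep_rv P u v by exact: (walk_increment_indep G_countable w_walk).
have vu : indep_rv P v u by move=> A B; rewrite setIC uv mulrC.
have vlaw (A : set G) : pr (v @^-1` A) = pr (w m' @^-1` A).
  exact: (walk_increment_law G_countable w_walk).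
have wE x : w n x = (u x * v x)%g by rewrite /u /v /walk_increment mulVKg mm'.
pose B1 := [set x | L%:R <= gp o (act (u x) o) (act (v x)^-1%g o)].
pose B2 := [set x | L%:R <= gp o (act (u x)^-1%g o) (act (v x) o)].
pose B3 := u @^-1` [set g | `[g] <= 2 * L%:R + 6 * delta + 1].
pose B4 := v @^-1` [set g | `[g] <= 2 * L%:R + 6 * delta + 1].
have mB1 : measurable B1.
  exact: (measurable_discrete_rv2 G_countable
    (fun g h => L%:R <= gp o (act g o) (act h^-1%g o)) mu_ mv).
have mB2 : measurable B2.
  exact: (measurable_discrete_rv2 G_countable
    (fun g h => L%:R <= gp o (act g^-1%g o) (act h o)) mu_ mv).
have mB3 : measurable B3 by exact: mu_.
have mB4 : measurable B4 by exact: mv.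
have pB1 : pr B1 <= eps / 4.
  apply: (pr_condition_le G_countable
    (S := fun h => [set g | L%:R <= gp o (act g o) (act h^-1%g o)]) mu_ mv) => // h.
  exact: HN1.
have pB2 : pr B2 <= eps / 4.
  apply: (pr_condition_le G_countable
    (S := fun g => [set h | L%:R <= gp o (act g^-1%g o) (act h o)]) mv mu_) => // g.
  rewrite vlaw; have -> : [set h | L%:R <= gp o (act g^-1%g o) (act h o)] =
      [set h | L%:R <= gp o (act h o) (act g^-1%g o)].
    by apply/seteqP; split=> h /=; rewrite gromov_productC.
  exact: HN1.
have pB3 : pr B3 <= eps / 4 by exact: HN2.
have pB4 : pr B4 <= eps / 4 by rewrite /B4 vlaw; exact: HN2.
apply: (@le_trans _ _ (pr ((B1 `|` B2) `|` (B3 `|` B4)))).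
  apply: le_pr.
  - apply: (antipodal_rv (v := fun x => (w n x)^-1%g)) => // A.
    exact: (mw n [set g | A g^-1%g]).
  - by do 2?apply: measurableU.
  move=> x /= nanti; apply: contrapT.
  move=> /not_orP[/not_orP[/negP + /negP +] /not_orP[/negP + /negP]].
  rewrite -!ltNge => h1 h2 h3 h4; apply: nanti; rewrite wE.
  exact: antipodal_product_inverse h1 h2 h3 h4.
have := prU P (measurableU _ _ mB1 mB2) (measurableU _ _ mB3 mB4).
have := prU P mB1 mB2; have := prU P mB3 mB4.
move: pB1 pB2 pB3 pB4; clear; lra.
Qed.

End Escape.

(** * Words and word metrics *)

Section Words.
Context {G : groupType}.
Implicit Types (B S T : set G) (a : G * bool) (w : seq (G * bool)).

Definition inverse_letter a : G * bool := (a.1, ~~ a.2).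

Lemma letter_valueV a : letter_value (inverse_letter a) = (letter_value a)^-1%g.
Proof. by case: a => g []; rewrite /letter_value /= ?invgK. Qed.

Lemma word_value_nil : word_value (G := G) [::] = 1%g.
Proof. by rewrite /word_value big_nil. Qed.

Lemma word_value_cons a w : word_value (a :: w) = (letter_value a * word_value w)%g.
Proof. by rewrite /word_value big_cons. Qed.

Lemma word_value_cat w1 w2 : word_value (w1 ++ w2) = (word_value w1 * word_value w2)%g.
Proof. by rewrite /word_value big_cat. Qed.

Lemma word_over_cons B a w : word_over B (a :: w) <-> B a.1 /\ word_over B w.
Proof.
split=> [aw|[Ba Bw] b]; last by rewrite inE => /orP[/eqP ->|/Bw].
by split=> [|b bw]; apply: aw; rewrite inE ?eqxx // bw orbT.
Qed.

Lemma word_over_cat B w1 w2 : word_over B w1 -> word_over B w2 -> word_over B (w1 ++ w2).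
Proof. by move=> h1 h2 a; rewrite mem_cat => /orP[/h1|/h2]. Qed.

Lemma generated_subgroup_subgroup B : subgroup (generated_subgroup B).
Proof.
split=> [|x y]; rewrite !inE; first by move=> H [] [+ _] _; rewrite inE.
by move=> Hx Hy H HB; have [[_ +] _] := HB; move=> /(_ x y); rewrite !inE; apply; [exact: Hx|exact: Hy].
Qed.

Lemma sub_generated_subgroup B : B `<=` generated_subgroup B.
Proof. by move=> b Bb H [_]; apply. Qed.

Lemma generated_subgroupV B g : generated_subgroup B g -> generated_subgroup B g^-1%g.
Proof.
have [+ +] := generated_subgroup_subgroup B; rewrite inE => B1 /(_ 1%g g).
by rewrite !inE mul1g => h Bg; exact: h.
Qed.

(** Elements that preserve [W] by left translation, as do their inverses, form a
    subgroup. *)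
Lemma generated_subgroup_sub B (W : set G) : W 1%g ->
  (forall a y, B a.1 -> W y -> W (letter_value a * y)%g) -> generated_subgroup B `<=` W.
Proof.
move=> W1 BW h Bh; suff /(_ _ W1)[+ _] : forall y, W y -> W (h * y)%g /\ W (h^-1 * y)%g.
  by rewrite mulg1.
apply: (Bh [set x | forall y, W y -> W (x * y)%g /\ W (x^-1 * y)%g]); split.
  split=> [|x z]; rewrite !inE /=; first by move=> y Wy; rewrite invg1 mul1g.
  move=> Wx Wz y Wy; rewrite invgM invgK -!mulgA; split.
    exact: (Wx _ (Wz _ Wy).2).1.
  exact: (Wz _ (Wx _ Wy).2).1.
by move=> b Bb y Wy; split; [exact: (BW (b, false))|exact: (BW (b, true))].
Qed.

Lemma generated_subgroup_word B h : generated_subgroup B h ->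
  exists2 w, word_over B w & word_value w = h.
Proof.
move=> Bh; pose W := [set h | exists2 w, word_over B w & word_value w = h].
apply: (@generated_subgroup_sub B W _ _ h Bh).
  by exists [::]; rewrite ?word_value_nil.
move=> a y Ba [w Bw <-]; exists (a :: w); first exact/word_over_cons.
exact: word_value_cons.
Qed.

Lemma finite_upper_bound (I : choiceType) (A : set I) (Q : I -> nat -> Prop) :
  finite_set A -> (forall i, A i -> exists n, Q i n) ->
  (forall i m n, (m <= n)%N -> Q i m -> Q i n) -> exists n, forall i, A i -> Q i n.
Proof.
move=> /finite_seqP[s ->] AQ Qmono.
have /choice[f fQ] : forall i, exists n, i \in s -> Q i n.
  move=> i; have [/AQ[n Qn]|] := boolP (i \in s); first by exists n.
  by exists 0%N.
have [D sD] := seq_upper_bound s f.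
by exists D => i iS; apply: Qmono (sD i iS) (fQ i iS).
Qed.

(** Translate letter by letter; [K] is the maximal length of the translation of one of
    the finitely many letters. *)
Lemma word_translation S T : finite_set S -> S `<=` generated_subgroup T ->
  exists K, forall w, word_over S w -> exists w',
    [/\ word_over T w', word_value w' = word_value w & (size w' <= K * size w)%N].
Proof.
move=> finS ST.
pose Q s n := forall b, exists w,
  [/\ word_over T w, word_value w = letter_value (s, b) & (size w <= n)%N].
have [K HK] : exists K, forall s, S s -> Q s K.
  apply: finite_upper_bound => // [s Ss|s m n mn Qm b].
    have [w1 Tw1 v1] := generated_subgroup_word (ST s Ss).
    have [w2 Tw2 v2] := generated_subgroup_word (generated_subgroupV (ST s Ss)).
    exists (maxn (size w1) (size w2)) => -[].
      by exists w2; split=> //; exact: leq_maxr.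
    by exists w1; split=> //; exact: leq_maxl.
  by have [w [? ? wm]] := Qm b; exists w; split=> //; exact: leq_trans mn.
exists K; elim=> [|a w IH]; first by exists [::].
move=> /word_over_cons[Sa Sw]; have [w1 [Tw1 v1 s1]] := IH Sw.
have [w2 [Tw2 v2 s2]] := HK a.1 Sa a.2; exists (w2 ++ w1); split.
- exact: word_over_cat.
- by rewrite word_value_cat word_value_cons v1 v2; case: (a).
- by rewrite size_cat /= mulnS leq_add.
Qed.

Variable R : realType.

Lemma word_length_le S w : word_over S w -> word_length R S (word_value w) <= (size w)%:R.
Proof. by move=> Sw; apply: ge_inf; [exists 0 => _ [w' _ <-]|exists w]. Qed.

Lemma le_word_length S g (c : R) : generated_subgroup S g ->
  (forall w, word_over S w -> word_value w = g -> c <= (size w)%:R) ->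
  c <= word_length R S g.
Proof.
move=> /generated_subgroup_word[w Sw wg] cS; apply: lb_le_inf.
  by exists (size w)%:R, w.
by move=> _ [w' [Sw' w'g] <-]; exact: cS.
Qed.

End Words.

(** * Ping-pong: antipodal generators *)

Section AntipodalGenerators.
Context {R : realType} {G : groupType} {X : metricType R}.
Variables (act : G -> X -> X) (act_isom : isometric_action act).
Variable delta : R.
Hypothesis hyp : forall x y z w : X,
  Num.min (gromov_product w x z) (gromov_product w z y) - delta <= gromov_product w x y.
Variable o : X.

Local Notation "`[ g ]" := (displacement act o g) (format "`[ g ]").
Local Notation d := (@mdist R X).

Variable B : set G.
Hypothesis B_antipodal : forall a b : G * bool, B a.1 -> B b.1 -> a != b ->
  antipodal act delta o (letter_value a) (letter_value b).

Implicit Types (a b : G * bool) (w : seq (G * bool)).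

(** By [chain_step] along the orbit path of the word, run through from its end: [x] is
    the end, and [y], [z], [t] are the second, first and zeroth points. *)
Lemma reduced_word_displacementS a w : word_over B (a :: w) -> reduced_word (a :: w) ->
  `[word_value w] + 1 <= `[word_value (a :: w)].
Proof.
elim: w a => [|b w IH] a /word_over_cons[Ba Bw].
  rewrite word_value_cons word_value_nil mulg1 displacement1 // => _.
  have aV : a != inverse_letter a by apply/eqP; case: (a) => ? [].
  have [+ _] := B_antipodal (b := inverse_letter a) Ba Ba aV.
  rewrite letter_valueV mdist_orbit //.
  have := displacementM act_isom o (letter_value a)^-1%g (letter_value a)^-1%g.
  rewrite displacementV //; have := hyperbolic_constant_ge0 hyp o; lra.
rewrite /reduced_word /= => /andP[ba bw]; have [Bb _] := (word_over_cons _ _ _).1 Bw.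
have ab : inverse_letter a != b by rewrite eq_sym.
have [anti1 anti2] := B_antipodal (a := inverse_letter a) Ba Bb ab.
set g := word_value _; set h := word_value (a :: _).
have gE : g = (letter_value b * word_value w)%g by exact: word_value_cons.
have hE : h = (letter_value a * g)%g by exact: word_value_cons.
have := @chain_step _ _ _ hyp 1 (act h o) (act (letter_value a * letter_value b)%g o)
  (act (letter_value a) o) o.
have -> : d (act (letter_value a * letter_value b)%g o) (act (letter_value a) o) =
    `[letter_value b].
  by rewrite metric_sym mdist_orbit // mulKg.
have -> : d (act (letter_value a * letter_value b)%g o) o =
    d (act (letter_value (inverse_letter a)) o) (act (letter_value b) o).
  by rewrite letter_valueV mdist_orbit // invgK metric_sym.
have -> : d (act (letter_value a) o) o = `[letter_value a] by rewrite metric_sym.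
have -> : d (act h o) (act (letter_value a * letter_value b)%g o) = `[word_value w].
  by rewrite metric_sym mdist_orbit // hE gE [X in (_^-1 * X)%g]mulgA mulKg.
have -> : d (act h o) (act (letter_value a) o) = `[g].
  by rewrite metric_sym mdist_orbit // hE mulKg.
have -> : d (act h o) o = `[h] by rewrite metric_sym.
apply=> //; last by rewrite gE -word_value_cons; exact: IH.
by move: anti1; rewrite letter_valueV displacementV.
Qed.

Lemma reduced_word_size w : word_over B w -> reduced_word w ->
  (size w)%:R <= `[word_value w].
Proof.
elim: w => [|a w IH] Baw raw; first by rewrite displacement_ge0.
have := reduced_word_displacementS Baw raw.
have [_ /IH IHw] := (word_over_cons _ _ _).1 Baw; rewrite -natr1.
by have := IHw (path_sorted raw); lra.
Qed.

(** The first letter of a reduced word is visible from the endpoint of its path: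
    this endpoint cannot be in the directions of two different letters. *)
Lemma reduced_word_inj w1 w2 : word_over B w1 -> word_over B w2 ->
  reduced_word w1 -> reduced_word w2 -> word_value w1 = word_value w2 -> w1 = w2.
Proof.
have toward a w : word_over B (a :: w) -> reduced_word (a :: w) ->
    d (act (word_value (a :: w)) o) (act (letter_value a) o) + 1 <=
    d (act (word_value (a :: w)) o) o.
  move=> Baw raw; have := reduced_word_displacementS Baw raw.
  rewrite metric_sym mdist_orbit // (metric_sym _ o) {2}word_value_cons mulKg.
  exact.
elim: w1 w2 => [|a w1 IH] [|b w2] // Bw1 Bw2 r1 r2.
- move=> E; have := reduced_word_size Bw2 r2.
  by rewrite -E word_value_nil displacement1 // leNgt ltr0n.
- move=> E; have := reduced_word_size Bw1 r1.
  by rewrite E word_value_nil displacement1 // leNgt ltr0n.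
have [[Ba Bw1'] [Bb Bw2']] := ((word_over_cons _ _ _).1 Bw1, (word_over_cons _ _ _).1 Bw2).
have [ab|ab] := eqVneq a b.
  rewrite ab !word_value_cons => /mulgI E; congr (_ :: _).
  exact: (IH _ Bw1' Bw2' (path_sorted r1) (path_sorted r2) E).
move=> E; have := toward _ _ Bw2 r2; rewrite -E => toward_b.
have toward_a := toward _ _ Bw1 r1.
have [anti1 anti2] := B_antipodal Ba Bb ab.
have := @chain_step _ _ _ hyp 1 (act (word_value (a :: w1)) o) (act (letter_value a) o) o
  (act (letter_value b) o) ltr01.
rewrite (metric_sym (act (letter_value a) o) o) => /(_ anti1 anti2 toward_a) away.
by exfalso; clear E; lra.
Qed.

Lemma generated_subgroup_reduced_word h : generated_subgroup B h ->
  exists w, [/\ word_over B w, reduced_word w & word_value w = h].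
Proof.
move=> Bh; pose W := [set h | exists w, [/\ word_over B w, reduced_word w & word_value w = h]].
apply: (@generated_subgroup_sub G B W _ _ h Bh).
  by exists [::]; rewrite word_value_nil.
move=> a y Ba [[|b w] [Bw rw <-]].
  exists [:: a]; split=> //; first exact/word_over_cons.
  by rewrite word_value_cons.
have [->|ba] := eqVneq b (inverse_letter a).
  exists w; split; [by have [] := (word_over_cons _ _ _).1 Bw|exact: path_sorted rw|].
  by rewrite word_value_cons letter_valueV mulVKg.
exists (a :: b :: w); split; first exact/word_over_cons.
  by rewrite /reduced_word /= ba.
by rewrite word_value_cons.
Qed.

Lemma antipodal_generators_free : free_subgroup (generated_subgroup B).
Proof.
split; first exact: generated_subgroup_subgroup.
exists B => [|h Bh]; first exact: sub_generated_subgroup.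
have [w [Bw rw wh]] := generated_subgroup_reduced_word Bh.
exists w; split=> // w' [Bw' rw' w'h].
by apply: reduced_word_inj => //; rewrite wh w'h.
Qed.

(** Displacement lies between the two word lengths: it is at least the length in the
    free basis, and at most a multiple of the length in the ambient group. *)
Lemma antipodal_generators_undistorted : finite_set B ->
  undistorted R (generated_subgroup B).
Proof.
move=> finB; split; first exact: generated_subgroup_subgroup.
  by exists B.
move=> S T finS SB finT TG.
have ST : S `<=` generated_subgroup T by rewrite TG.
have BS : B `<=` generated_subgroup S by rewrite SB; exact: sub_generated_subgroup.
have [K1 HK1] := word_translation finS ST.
have [K2 HK2] := word_translation finB BS.
have [K3 HK3] : exists K3, forall t, T t -> `[t] <= K3%:R.
  apply: (@finite_upper_bound _ T (fun t n => `[t] <= n%:R)) => //.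
    by move=> t _; exact: natr_above.
  by move=> t m n mn /le_trans; apply; rewrite ler_nat.
have disp w : word_over T w -> `[word_value w] <= K3%:R * (size w)%:R.
  elim: w => [|a w IH]; first by rewrite word_value_nil displacement1 // mulr0.
  move=> /word_over_cons[Ta /IH IHw]; rewrite word_value_cons.
  apply: le_trans (displacementM act_isom o _ _) _.
  rewrite -natr1 mulrDr mulr1 addrC; apply: lerD => //.
  by rewrite /letter_value; case: ifP => _; rewrite ?displacementV //; exact: HK3.
pose K : R := (K1 + K2 * K3).+1%:R.
have K0 : 0 < K by rewrite ltr0n.
exists K, 0; split=> //; first by rewrite ler1n.
move=> x y Bx By; rewrite subr0 addr0 /word_dist.
have Bh : generated_subgroup B (x^-1 * y)%g.
  have [_ Bdiv] := generated_subgroup_subgroup B.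
  have := Bdiv x^-1%g y^-1%g; rewrite !inE invgK; apply; exact: generated_subgroupV.
have Sh : generated_subgroup S (x^-1 * y)%g by rewrite SB.
have Th : generated_subgroup T (x^-1 * y)%g by rewrite TG.
split.
  apply: le_word_length => // t Tt th.
  rewrite ler_pdivrMl //.
  have [r [Br rr rh]] := generated_subgroup_reduced_word Bh.
  have [s [Ss sr size_s]] := HK2 r Br.
  rewrite -rh -sr; apply: le_trans (word_length_le R Ss) _.
  have h1 : (size s)%:R <= K2%:R * (size r)%:R :> R by rewrite -natrM ler_nat.
  have h2 := reduced_word_size Br rr.
  have h3 := disp t Tt; rewrite th -rh in h3.
  apply: le_trans h1 _; apply: (@le_trans _ _ (K2%:R * (K3%:R * (size t)%:R))).
    by rewrite ler_wpM2l // (le_trans h2).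
  by rewrite -!natrM ler_nat mulnA leq_mul2r; apply/orP; right; lia.
rewrite -ler_pdivrMl //; apply: le_word_length => // s Ss sh.
rewrite ler_pdivrMl //.
have [t [Tt ts size_t]] := HK1 s Ss.
rewrite -sh -ts; apply: le_trans (word_length_le R Tt) _.
rewrite -natrM ler_nat; apply: leq_trans size_t _.
by rewrite leq_mul2r; apply/orP; right; lia.
Qed.

End AntipodalGenerators.

(** * Independent random walks *)

Section NonelementaryMeasure.
Context {R : realType} {G : groupType} {X : metricType R}.
Variables (act : G -> X -> X) (act_isom : isometric_action act).
Variable delta : R.
Hypothesis hyp : forall x y z w : X,
  Num.min (gromov_product w x z) (gromov_product w z y) - delta <= gromov_product w x y.
Variable o : X.
Hypothesis G_countable : countable [set: G].
Variable mu : probability (discrete G) R.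
Hypothesis mu_nonelementary : nonelementary_measure mu act.
Context {d : measure_display} {Omega : measurableType d}.
Variable P : probability Omega R.
Local Notation pr := (prob P).

(** The loxodromic elements of the definition are products of elements of the
    support, hence are reached by the walk. *)
Lemma walk_schottky_family (w : nat -> Omega -> G) : random_walk mu P w ->
  forall M r, exists m C F,
    [/\ size F = M, schottky act o C r F & forall s, s \in F -> 0 < pr (w m @^-1` [set s])].
Proof.
move=> w_walk M r; have [_ [g [h [Hg Hh lox_g lox_h gh0]]]] := mu_nonelementary.
have [ng reach_g] := reachable_semigroup G_countable w_walk Hg.
have [nh reach_h] := reachable_semigroup G_countable w_walk Hh.
have [p sp] := loxodromic_stretched act_isom hyp o lox_g.
have [q sq] := loxodromic_stretched act_isom hyp o lox_h.
have reachX a n m : reachable P w n a -> reachable P w (m * n)%N (a ^+ m)%g.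
  move=> ra; elim: m => [|m IH].
    by rewrite expg0; exact: (reachable0 G_countable w_walk).
  by rewrite mulSn expgS; exact: (reachableM G_countable w_walk).
have gp_commute : commute g (g ^+ p)%g by apply: commuteX.
have hq_commute : commute h (h ^+ q)%g by apply: commuteX.
have transv := disjoint_fixed_points_transverse act_isom hyp (o := o) gh0.
have [m [C [F [sF schF rF]]]] := large_schottky_family act_isom hyp M r
  (reachable0 G_countable w_walk) (reachableM G_countable w_walk)
  (reachX _ _ p reach_g) (reachX _ _ q reach_h) sp sq
  (transv _ _ gp_commute hq_commute sp sq)
  (transv _ _ (commuteV gp_commute) hq_commute (stretchedV act_isom sp) sq)
  (transv _ _ gp_commute (commuteV hq_commute) sp (stretchedV act_isom sq))
  (transv _ _ (commuteV gp_commute) (commuteV hq_commute)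
    (stretchedV act_isom sp) (stretchedV act_isom sq)).
by exists m, C, F.
Qed.

Lemma walk_escapes (w : nat -> Omega -> G) (b : bool) : random_walk mu P w ->
  escapes act o P (fun n x => letter_value (w n x, b)) /\
  avoids_directions act o P (fun n x => letter_value (w n x, b)).
Proof.
move=> w_walk; have sch := walk_schottky_family w_walk.
have rv := walk_rv G_countable w_walk.
case: b; rewrite /letter_value /=; last first.
  have conv := walk_convolution G_countable w_walk.
  split; first exact: (convolution_powers_escape act_isom hyp G_countable).
  exact: (convolution_powers_avoid_directions act_isom hyp G_countable).
have conv := inverse_walk_convolution G_countable w_walk.
have rvV n : discrete_rv (fun x => (w n x)^-1%g).
  by move=> A; exact: (rv n [set g | A g^-1%g]).
have schV M r : exists m C F, [/\ size F = M, schottky act o C r F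
    & forall s, s \in F -> 0 < pr ((fun x => (w m x)^-1%g) @^-1` [set s])].
  have [m [C [F [sF schF rF]]]] := sch M r.
  exists m, C, [seq s^-1%g | s <- F]; split; first by rewrite size_map.
    exact: schottkyV.
  move=> _ /mapP[s sF' ->]; have -> : (fun x => (w m x)^-1%g) @^-1` [set s^-1%g] = w m @^-1` [set s].
    by apply/seteqP; split=> x /= => [/invg_inj|->].
  exact: rF.
split; first exact: (convolution_powers_escape act_isom hyp G_countable).
exact: (convolution_powers_avoid_directions act_isom hyp G_countable).
Qed.

Variables (k : nat) (w : 'I_k -> nat -> Omega -> G).
Hypothesis w_walks : independent_random_walks mu P w.

Lemma letter_rv i n b : discrete_rv (fun x => letter_value (w i n x, b)).
Proof.
have [walks _] := w_walks => A.
exact: (walk_rv G_countable (walks i) n [set g | A (letter_value (g, b))]).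
Qed.

Lemma walks_indep i j n b c : i != j -> indep_rv P
  (fun x => letter_value (w i n x, b)) (fun x => letter_value (w j n x, c)).
Proof.
move=> ij A B; have [_ indep] := w_walks.
pose E l := if l == i then (fun x => letter_value (w i n x, b)) @^-1` A
            else (fun x => letter_value (w j n x, c)) @^-1` B.
have := indep [:: i; j] E; rewrite /= inE ij => /(_ isT).
have -> : \bigcap_(l in [set` [:: i; j]]) E l = (fun x => letter_value (w i n x, b)) @^-1` A
    `&` (fun x => letter_value (w j n x, c)) @^-1` B.
  apply/seteqP; split=> [x h|x [hA hB] l /=].
    split; first by have := h i; rewrite /E eqxx /= !inE eqxx; apply.
    by have := h j; rewrite /E eq_sym (negPf ij) /= !inE eqxx orbT; apply.
  by rewrite !inE /E => /orP[/eqP ->|/eqP ->]; rewrite ?eqxx // eq_sym (negPf ij).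
rewrite !big_cons big_nil mule1 /E eqxx eq_sym (negPf ij) /prob => -> //; last first.
  have sig l (D : set G) a : process_sigma_algebra (w l)
      ((fun x => letter_value (w l n x, a)) @^-1` D).
    apply: sub_sigma_algebra; exists n => //.
    by exists [set g | D (letter_value (g, a))] => //; rewrite setTI.
  move=> l; rewrite !inE => /orP[] /eqP ->; rewrite ?eqxx; first exact: sig.
  by rewrite eq_sym (negPf ij); exact: sig.
by rewrite fineM ?fin_num_measure //; exact: letter_rv.
Qed.

Lemma antipodal_sym g h : antipodal act delta o g h -> antipodal act delta o h g.
Proof. by rewrite /antipodal metric_sym => -[]. Qed.

Lemma letters_antipodal (a b : 'I_k * bool) : a != b -> forall eps, 0 < eps ->
  exists N, forall n, (N <= n)%N ->
    pr [set x | ~ antipodal act delta o (letter_value (w a.1 n x, a.2))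
                                        (letter_value (w b.1 n x, b.2))] <= eps.
Proof.
case: a b => [i s] [j t] /=; have [walks _] := w_walks.
have [<-|ij] := eqVneq i j; last first.
  move=> _; have [escu diru] := walk_escapes s (walks i).
  have [escv _] := walk_escapes t (walks j).
  apply: (independent_antipodal delta G_countable _ _ _ escu escv diru) => n.
  - exact: letter_rv.
  - exact: letter_rv.
  - by apply: walks_indep; rewrite eq_sym.
rewrite xpair_eqE eqxx /= => st.
have [esc dir] := walk_escapes false (walks i).
have half := walk_inverse_antipodal act_isom hyp G_countable (walks i) esc dir.
case: s st; case: t => // _ eps /half[N HN]; exists N => n Nn.
suff -> : [set x | ~ antipodal act delta o (w i n x)^-1%g (w i n x)] =
    [set x | ~ antipodal act delta o (w i n x) (w i n x)^-1%g] by exact: HN.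
by apply/seteqP; split=> x; apply: contra_not; exact: antipodal_sym.
Qed.

(** A countable union over the codes of the [k]-tuples of values. *)
Lemma measurable_discrete_rvs (n : nat) (Q : ('I_k -> G) -> Prop) :
  measurable [set x | Q (fun j => w j n x)].
Proof.
have /countable_injP[c c_inj'] := G_countable.
have c_inj : injective c by move=> a b; apply: c_inj'; rewrite inE.
pose E m := if unpickle m is Some t then
    [set x | forall j, c (w j n x) = (t : {ffun 'I_k -> nat}) j] else set0.
pose D m := exists2 x, E m x & Q (fun j => w j n x).
have -> : [set x | Q (fun j => w j n x)] = \bigcup_(m in D) E m.
  apply/seteqP; split=> [x Qx|x [m [y Ey Qy] Ex]].
    pose t := [ffun j => c (w j n x)].
    have Ex : E (pickle t) x by rewrite /E pickleK /= => j; rewrite ffunE.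
    by exists (pickle t) => //; exists x.
  move: Ex Ey; rewrite /E; case: unpickle => // t Ex Ey /=.
  suff -> : (fun j => w j n x) = (fun j => w j n y) by [].
  by apply/funext => j; apply: c_inj; rewrite Ex Ey.
apply: bigcup_measurable => m _; rewrite /E; case: unpickle => [t|]; last exact: measurable0.
have -> : [set x | forall j, c (w j n x) = t j] =
    \bigcap_(j in [set` enum 'I_k]) (fun x => letter_value (w j n x, false)) @^-1` [set g | c g = t j].
  by apply/seteqP; split=> x h j => [_|]; [exact: h|apply: (h j); rewrite /= mem_enum].
apply: fin_bigcap_measurable; first exact: finite_seq.
by move=> j _; exact: letter_rv.
Qed.

Lemma walk_subgroup_free_undistorted n x :
  (forall a b : 'I_k * bool, a != b -> antipodal act delta o
     (letter_value (w a.1 n x, a.2)) (letter_value (w b.1 n x, b.2))) ->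
  free_subgroup (walk_subgroup w n x) /\
    (finitely_generated [set: G] -> undistorted R (walk_subgroup w n x)).
Proof.
move=> anti.
have range_anti : forall a b : G * bool, range (fun j => w j n x) a.1 ->
    range (fun j => w j n x) b.1 -> a != b ->
    antipodal act delta o (letter_value a) (letter_value b).
  move=> [g s] [h t] /= [i _ <-] [j _ <-] ab; apply: (anti (i, s) (j, t)).
  by apply: contraNneq ab => -[-> ->].
split; first exact: (antipodal_generators_free act_isom hyp range_anti).
move=> _; apply: (antipodal_generators_undistorted act_isom hyp range_anti).
exact: finite_image.
Qed.

(** A union bound over the finitely many pairs of letters. *)
Lemma free_undistorted_cvg :
  P [set x | free_subgroup (walk_subgroup w n x) /\
       (finitely_generated [set: G] -> undistorted R (walk_subgroup w n x))]
    @[n --> \oo] --> 1%E.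
Proof.
pose F n := [set x | free_subgroup (walk_subgroup w n x) /\
  (finitely_generated [set: G] -> undistorted R (walk_subgroup w n x))].
rewrite -/((fun n => P (F n)) @ \oo --> 1%E).
have mF n : measurable (F n).
  exact: (measurable_discrete_rvs n (fun f => free_subgroup (generated_subgroup (range f)) /\
    (finitely_generated [set: G] -> undistorted R (generated_subgroup (range f))))).
pose pairs := [seq ab : ('I_k * bool) * ('I_k * bool) <- enum {: ('I_k * bool) * ('I_k * bool)} | ab.1 != ab.2].
pose bad n (ab : ('I_k * bool) * ('I_k * bool)) := [set x | ~ antipodal act delta o
  (letter_value (w ab.1.1 n x, ab.1.2)) (letter_value (w ab.2.1 n x, ab.2.2))].
have mbad n ab : measurable (bad n ab).
  by apply: (antipodal_rv act delta o G_countable (u := fun x => letter_value (w ab.1.1 n x, ab.1.2))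
    (v := fun x => letter_value (w ab.2.1 n x, ab.2.2))); exact: letter_rv.
have badF n : ~` F n `<=` \big[setU/set0]_(ab <- pairs) bad n ab.
  move=> x nF; rewrite -bigcup_seq; apply: contrapT => nbad; apply: nF.
  apply: walk_subgroup_free_undistorted => a b ab; apply: contrapT => nanti.
  by apply: nbad; exists (a, b) => //=; rewrite mem_filter /= ab mem_enum.
have prF e : 0 < e -> exists N, forall n, (N <= n)%N -> 1 - e <= pr (F n).
  move=> e0; pose c : R := e / (size pairs).+1%:R.
  have c0 : 0 < c by rewrite divr_gt0.
  have [N HN] : exists N, forall ab, ab \in pairs -> forall n, (N <= n)%N -> pr (bad n ab) <= c.
    apply: (@finite_upper_bound _ [set` pairs]
      (fun ab N => forall n, (N <= n)%N -> pr (bad n ab) <= c)); first exact: finite_seq.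
      move=> [a b] /=; rewrite mem_filter /= => /andP[ab _].
      exact: letters_antipodal.
    by move=> ab m n mn Hm l nl; apply: Hm; exact: leq_trans nl.
  exists N => n Nn.
  have : pr (~` F n) <= e.
    apply: (@le_trans _ _ (\sum_(ab <- pairs) pr (bad n ab))).
      apply: le_trans (pr_bigU P pairs (mbad n)); apply: le_pr => //.
        exact: measurableC.
      exact: bigsetU_measurable.
    apply: (@le_trans _ _ (\sum_(ab <- pairs) c)).
      by rewrite big_seq [leRHS]big_seq; apply: ler_sum => ab abp; exact: HN.
    rewrite sumr_const_seq -mulr_natr /c mulrAC ler_pdivrMr // ler_pM2l //.
    by rewrite ler_nat.
  by rewrite prC // lerBlDl -lerBlDr.
have -> : (fun n => P (F n)) = EFin \o (fun n => pr (F n)).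
  by apply/funext => n /=; rewrite prE.
apply/cvg_EFin; first exact: nearW.
apply/cvgrPdist_le => e e0; have [N HN] := prF e e0; exists N => // n /= Nn.
by rewrite ger0_norm ?subr_ge0 ?pr_le1 // lerBlDl -lerBlDr HN.
Qed.

End NonelementaryMeasure.

Unset Implicit Arguments.
Set Strict Implicit.
Set Printing Implicit Defensive.

Theorem corollary1p6 (R : realType) (G : groupType) (X : metricType R)
  (act : G -> X -> X)
  (G_countable : countable [set: G])
  (X_separable : separable X)
  (X_hyperbolic : hyperbolic X)
  (act_isometric : isometric_action act)
  (act_nonelementary : nonelementary_on act [set: G])
  (mu : probability (discrete G) R)
  (mu_nonelementary : nonelementary_measure mu act)
  (k : nat) (k_ge1 : (1 <= k)%N)
  (d : measure_display) (Omega : measurableType d) (P : probability Omega R)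
  (w : 'I_k -> nat -> Omega -> discrete G)
  (w_walks : independent_random_walks mu P w) :
  (fun n : nat =>
     P [set omega | free_subgroup (walk_subgroup w n omega) /\
          (finitely_generated [set: G] ->
           undistorted R (walk_subgroup w n omega))])
    @ \oo --> 1%E.
Proof.
have [delta _ hyp] := X_hyperbolic.
have [_ [_ [_ [_ _ [x0 _] _ _]]]] := mu_nonelementary.
exact: (free_undistorted_cvg act_isometric hyp x0 G_countable mu_nonelementary w_walks).
Qed.
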